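(* Let $G=[a_1\times a_2\times\cdots\times a_k]$ be a $k$-dimensional grid ($k\ge 2$) with $a_i\ge 2^{22}$ for each $1\le i\le k$. Then the one-to-one map $H^k:G\to Opt(G)$ constructed in the context satisfies $\mathrm{dilation}(H^k)\le 3k$ and has edge congestion $O(k)$; that is, there is an absolute constant $C$ such that, for every such $G$, routing paths for $H^k$ can be chosen with edge congestion at most $Ck$.
   Context: Basic definitions. The grid $[a_1\times\cdots\times a_k]$ has as vertices the integer $k$-tuples $x=(x_1,\dots,x_k)$ with $1\le x_i\le a_i$, with $x,y$ adjacent iff $\sum_i|x_i-y_i|=1$. $Q_n$ is the graph on all $0/1$ strings of length $n$, two strings being adjacent iff they differ in exactly one coordinate. $Opt(G)=Q_n$ with $n=\lceil\log_2|V(G)|\rceil$ is the smallest hypercube with at least $|V(G)|$ vertices. For a one-to-one map $g:V(G)\to V(H)$, $\mathrm{dilation}(g)=\max\{dist_H(g(x),g(y)):xy\in E(G)\}$, where $dist_H$ is graph distance in $H$. A choice of routing paths for $g$ assigns to each edge $xy\in E(G)$ a path in $H$ (not necessarily shortest) joining $g(x)$ and $g(y)$; its edge congestion is the maximum, over all edges $vw\in E(H)$, of the number of routing paths containing $vw$. Put $e_0=0$, $e_i=\lceil\log_2(a_1\cdots a_i)\rceil$, $p_i=e_i-e_{i-1}$ (so $p_i\ge 22$ and $p_1+\cdots+p_k=n$), $P_i=a_{i+1}a_{i+2}\cdots a_k$, and $u_i=\lceil |V(G)|/2^{e_{i-1}}\rceil$. The subscript in $f(x)_j$ denotes the $j$-th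 coordinate. Construction of $H^k$. Maps $f_2,f_3,\dots,f_k$ on $V(G)$ are built in succession. Each $f_i$ takes values in the $i$-tuples $(z_1,\dots,z_i)$ of integers with $1\le z_j\le 2^{p_j}$ for $j<i$ and $1\le z_i\le u_i$. (1) The map $f_2$. Identify $x\in V(G)$ with the pair $(x_1,y)$, where $y=x_2+(x_3-1)a_2+(x_4-1)a_2a_3+\cdots+(x_k-1)a_2a_3\cdots a_{k-1}$. Let $R=(R_{ij})$, $1\le i\le a_1$, $j\ge 1$, be the $(0,1)$ matrix with $R_{i1}=\lfloor\frac{2^{e_1}-a_1}{a_1}i\rfloor-\lfloor\frac{2^{e_1}-a_1}{a_1}(i-1)\rfloor$ and $R_{ij}=R_{i-1,j-1}$ for $j>1$, row indices taken modulo $a_1$ in $\{1,\dots,a_1\}$. Put $N_{ij}=j+\sum_{t=1}^jR_{it}$ (with $N_{i0}=0$) and $c_{ij}=i+\sum_{s=1}^iR_{sj}$ (with $c_{0j}=0$). For all $1\le i\le a_1$, $j\ge 1$: if $R_{ij}=0$, then $f(i,N_{i,j-1}+1)=(c_{i-1,j}+1,j)$; if $R_{ij}=1$ and $j$ is odd, then $f(i,N_{i,j-1}+1)=(c_{i-1,j}+1,j)$ and $f(i,N_{i,j-1}+2)=(c_{i-1,j}+2,j)$; if $R_{ij}=1$ and $j$ is even, then $f(i,N_{i,j-1}+1)=(c_{i-1,j}+2,j)$ and $f(i,N_{i,j-1}+2)=(c_{i-1,j}+1,j)$. Then $f_2$ is the restriction of $f$ to $V(G)$ under the identification. (2) From $f_i$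 to $f_{i+1}$, for $i=2,\dots,k-1$. Blank levels. For $1\le j\le P_i$ let $s_i(j)=2^{p_i}-\lceil\frac{a_1\cdots a_i}{2^{e_{i-1}}}\rceil+\lfloor j\phi_i\rfloor-\lfloor(j-1)\phi_i\rfloor$, where $\phi_i=\lceil\frac{a_1\cdots a_i}{2^{e_{i-1}}}\rceil-\frac{a_1\cdots a_i}{2^{e_{i-1}}}$. Let $T=(t_{cd})$ be the $P_i\times 2^{p_i}$ matrix with $t_{cd}=s_i(c)/2^{p_i}$ for all $d$. Let $F(i)=(f_{cd})$ be a $(0,1)$ matrix of the same size that is a rounding of $T$ (each $f_{cd}$ is $\lfloor t_{cd}\rfloor$ or $\lceil t_{cd}\rceil$) with $|\sum_{d=1}^b(t_{cd}-f_{cd})|<1$ for every row $c$ and every $1\le b\le 2^{p_i}$, $|\sum_{c=1}^b(t_{cd}-f_{cd})|<1$ for every column $d$ and every $1\le b\le P_i$, and $|\sum_{c,d}(t_{cd}-f_{cd})|<1$. (Such a rounding exists; one is fixed.) For $1\le c\le P_i$ and $1\le d\le 2^{p_i}$, call the integer $(c-1)2^{p_i}+d$ blank if $f_{cd}=1$ and nonblank if $f_{cd}=0$. There are exactly $u_i$ nonblank integers in $\{1,\dots,P_i2^{p_i}\}$. Inflation. $I_i(z_1,\dots,z_i)=(z_1,\dots,z_{i-1},z_i')$, where $z_i'$ is the $z_i$-th smallest nonblank integer. Stacking. For $y=(y_1,\dots,y_i)\in I_i(f_i(V(G)))$ let $r=\lceil y_i/2^{p_i}\rceil$, let $\bar y_i\in\{1,\dots,2^{p_i}\}$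 be congruent to $y_i$ modulo $2^{p_i}$, and let $n_y$ be the number of $z\in I_i(f_i(V(G)))$ with $z_j=y_j$ for $1\le j\le i-1$, $z_i\equiv y_i\pmod{2^{p_i}}$ and $z_i\le r2^{p_i}$. Put $\sigma_i(y)=(y_1,\dots,y_{i-1},\bar y_i,n_y)$. Finally $f_{i+1}=\sigma_i\circ I_i\circ f_i$. (3) Hypercube labels. For $t\ge 22$, $Q_t$ has a spanning subgraph consisting of a cycle $x_1,x_2,\dots,x_e$ ($e=2^t/16$) together with exactly 15 leaves $x_{i,1},\dots,x_{i,15}$ attached to each $x_i$. Fix one and define the bijection $L_t:V(Q_t)\to\{1,\dots,2^t\}$ by $L_t(x_i)=16i$ and $L_t(x_{i,j})=16(i-1)+j$. (4) The embedding. One has $1\le f_k(x)_j\le 2^{p_j}$ for all $x\in V(G)$ and $1\le j\le k$, and $f_k$ is one-to-one. $H^k(x)\in V(Q_n)=V(Opt(G))$ is the concatenation, for $j=1,2,\dots,k$ in order, of the strings $L_{p_j}^{-1}(f_k(x)_j)\in V(Q_{p_j})$. *)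

(* Defs.v *)
(* MathComp *)
From mathcomp Require Import all_boot all_order all_algebra.

Set Implicit Arguments.
Unset Strict Implicit.
Unset Printing Implicit Defensive.

(** * Finite graphs, given by their adjacency relation *)

Section Graphs.

Variables (T : finType) (e : rel T).

Definition edges : {set {set T}} :=
  [set [set p.1; p.2] | p in [pred p : T * T | e p.1 p.2]].

(* Length of a shortest walk from x to y; it is #|T| when there is none. *)
Definition gdist (x y : T) : nat :=
  find (fun n => [exists q : n.-tuple T, path e x q && (last x q == y)])
       (iota 0 #|T|).

(* s is the vertex sequence, both ends included, of a path from u to v. *)
Definition joins (u v : T) (s : seq T) : bool :=
  if s is z :: q then [&& z == u, path e z q, last z q == v & uniq s]
  else false.

Definition path_edges (s : seq T) : seq {set T} :=
  [seq [set p.1; p.2] | p <- zip s (behead s)].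

End Graphs.

Section Embeddings.

Variables (T U : finType) (eT : rel T) (eU : rel U) (g : T -> U).

Definition dilation : nat :=
  \max_(x : T) \max_(y : T | eT x y) gdist eU (g x) (g y).

(* One path per undirected edge {x, y}; as x and y play symmetric roles, its
   vertex sequence may be listed from either end. *)
Definition routing (r : {set T} -> seq U) : Prop :=
  forall x y : T, eT x y ->
    joins eU (g x) (g y) (r [set x; y]) || joins eU (g y) (g x) (r [set x; y]).

Definition congestion (r : {set T} -> seq U) : nat :=
  \max_(B in edges eU) #|[set A in edges eT | B \in path_edges (r A)]|.

End Embeddings.

(** * Hypercubes *)

Definition cube (n : nat) : finType := n.-tuple bool.

Definition cube_adj (n : nat) : rel (cube n) :=
  fun u v => #|[set i : 'I_n | tnth u i != tnth v i]| == 1.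

Definition opt_dim (T : finType) : nat := up_log 2 #|T|.

(* x 1, ..., x e is a cycle of Q_t, with e = 2^t / 16; y i 1, ..., y i 15 are
   neighbours of x i; and every vertex of Q_t is listed exactly once. *)
Definition leafy_cycle (t : nat) (x : nat -> cube t) (y : nat -> nat -> cube t)
    : Prop :=
  let e := 2 ^ t %/ 16 in
  let cyc := [seq x i | i <- iota 1 e] in
  let leaves := [seq y i j | i <- iota 1 e, j <- iota 1 15] in
  [/\ cycle (@cube_adj t) cyc,
      forall i j, 1 <= i <= e -> 1 <= j <= 15 -> cube_adj (x i) (y i j)
    & perm_eq (cyc ++ leaves) (enum (cube t))].

(* The inverse of the labelling x_i |-> 16 i, x_(i,j) |-> 16 (i - 1) + j. *)
Definition unlabel (t : nat) (x : nat -> cube t) (y : nat -> nat -> cube t)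
    (m : nat) : cube t :=
  if 16 %| m then x (m %/ 16) else y (m %/ 16).+1 (m %% 16).

(** * Balanced roundings of matrices (rows 1..m, columns 1..n) *)

Section Rounding.
Import Order.TTheory GRing.Theory Num.Theory.
Local Open Scope ring_scope.

Definition balanced_rounding (m n : nat) (t : nat -> nat -> rat)
    (f : nat -> nat -> bool) : Prop :=
  [/\ forall c d, (1 <= c <= m)%N -> (1 <= d <= n)%N ->
        (f c d)%:Z = Num.floor (t c d) \/ (f c d)%:Z = Num.ceil (t c d),
      forall c b, (1 <= c <= m)%N -> (1 <= b <= n)%N ->
        `|\sum_(1 <= d < b.+1) (t c d - (f c d)%:R)| < 1,
      forall d b, (1 <= d <= n)%N -> (1 <= b <= m)%N ->
        `|\sum_(1 <= c < b.+1) (t c d - (f c d)%:R)| < 1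
    & `|\sum_(1 <= c < m.+1) \sum_(1 <= d < n.+1) (t c d - (f c d)%:R)| < 1].

End Rounding.

(** * The grid and the construction *)

Section Construction.

(* The side lengths are a 1, ..., a k; other values of a are never used. *)
Variables (k : nat) (a : nat -> nat).

(* Coordinates are stored shifted: x i : 'I_(a i.+1) stands for the integer
   (x i).+1, which is the coordinate of index i.+1. *)
Definition grid : finType := {dffun forall i : 'I_k, 'I_(a i.+1)}.

Definition grid_adj : rel grid :=
  fun x y => \sum_(i < k) `|x i - y i| == 1.

(* The coordinate x_j, for 1 <= j <= k. *)
Definition coord (x : grid) (j : nat) : nat :=
  if insub j.-1 is Some i then (x i).+1 else 0.

Definition e_ (i : nat) : nat := up_log 2 (\prod_(1 <= j < i.+1) a j).
Definition p_ (i : nat) : nat := e_ i - e_ i.-1.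
Definition P_ (i : nat) : nat := \prod_(i.+1 <= j < k.+1) a j.

(** ** The map f_2 *)

(* The integer quotients are the floors of (2^e_1 - a_1) / a_1 * i, etc. *)
Definition R1 (i : nat) : nat :=
  (2 ^ e_ 1 - a 1) * i %/ a 1 - (2 ^ e_ 1 - a 1) * i.-1 %/ a 1.

Fixpoint R_ (i j : nat) {struct j} : nat :=
  match j with
  | 0 => 0
  | 1 => R1 i
  | j'.+1 => R_ (if i == 1 then a 1 else i.-1) j'
  end.

Definition N_ (i j : nat) : nat := j + \sum_(1 <= t < j.+1) R_ i t.
Definition c_ (i j : nat) : nat := i + \sum_(1 <= s < i.+1) R_ s j.

(* For m >= 1, the j >= 1 such that N_(i,j-1) < m <= N_(i,j). *)
Definition chain_col (i m : nat) : nat :=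
  find (fun j => m <= N_ i j) (iota 0 m.+1).

(* f(i, m).  In column j the offset d = m - N_(i,j-1) is 1 if R_(i,j) = 0, and
   1 or 2 if R_(i,j) = 1; the two images are exchanged when j is even. *)
Definition chain (i m : nat) : nat * nat :=
  let j := chain_col i m in
  let d := m - N_ i j.-1 in
  if R_ i j == 0 then (c_ i.-1 j + 1, j)
  else if odd j then (c_ i.-1 j + d, j)
  else (c_ i.-1 j + (3 - d), j).

(* The integer y identified with (x_2, ..., x_k). *)
Definition flat (x : grid) : nat :=
  coord x 2
  + \sum_(3 <= j < k.+1) (coord x j).-1 * \prod_(2 <= l < j) a l.

Definition f2 (x : grid) : seq nat :=
  let z := chain (coord x 1) (flat x) in [:: z.1; z.2].

(** ** From f_i to f_(i+1) *)

Section Ring.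
Import Order.TTheory GRing.Theory Num.Theory.
Local Open Scope ring_scope.

Definition alpha (i : nat) : rat :=
  (\prod_(1 <= j < i.+1) a j)%N%:R / (2 ^ e_ i.-1)%N%:R.

Definition phi (i : nat) : rat := (Num.ceil (alpha i))%:~R - alpha i.

Definition s_ (i j : nat) : int :=
  (2 ^ p_ i)%N%:Z - Num.ceil (alpha i)
  + Num.floor (j%:R * phi i) - Num.floor (j.-1%:R * phi i).

Definition T_ (i c d : nat) : rat := (s_ i c)%:~R / (2 ^ p_ i)%N%:R.

End Ring.

Definition blank_rounding (i : nat) (f : nat -> nat -> bool) : Prop :=
  balanced_rounding (P_ i) (2 ^ p_ i) (T_ i) f.

(* F i is the matrix F(i), with rows and columns indexed from 1. *)
Variable F : nat -> nat -> nat -> bool.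

(* m = (c - 1) 2^p_i + d with 1 <= d <= 2^p_i. *)
Definition blank (i m : nat) : bool :=
  F i (m.-1 %/ 2 ^ p_ i).+1 (m.-1 %% 2 ^ p_ i).+1.

Definition nonblanks (i : nat) : seq nat :=
  [seq m <- iota 1 (P_ i * 2 ^ p_ i) | ~~ blank i m].

(* In an i-tuple z, represented as a sequence, z_j is nth 0 z j.-1. *)
Definition inflate (i : nat) (z : seq nat) : seq nat :=
  rcons (take i.-1 z) (nth 0 (nonblanks i) (nth 0 z i.-1).-1).

(* S stands for the set I_i(f_i(V(G))); r is the ceiling of y_i / 2^p_i. *)
Definition stack (i : nat) (S : seq (seq nat)) (y : seq nat) : seq nat :=
  let q := 2 ^ p_ i in
  let yi := nth 0 y i.-1 in
  let r := (yi.-1 %/ q).+1 in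
  let ybar := (yi.-1 %% q).+1 in
  let ny := count (fun z => [&& take i.-1 z == take i.-1 y,
                                nth 0 z i.-1 == yi %[mod q]
                              & nth 0 z i.-1 <= r * q]) (undup S) in
  take i.-1 y ++ [:: ybar; ny].

Definition next_f (i : nat) (f : grid -> seq nat) : grid -> seq nat :=
  let g x := inflate i (f x) in
  fun x => stack i [seq g z | z : grid] (g x).

(* f_from2 m is the map f_(m+2). *)
Fixpoint f_from2 (m : nat) : grid -> seq nat :=
  if m is m'.+1 then next_f m'.+2 (f_from2 m') else f2.

Definition f_ (i : nat) : grid -> seq nat := f_from2 (i - 2).

(** ** The embedding *)

Variables (X : forall t, nat -> cube t) (Y : forall t, nat -> nat -> cube t).

Definition Hk_string (x : grid) : seq bool :=
  flatten [seq tval (unlabel (@X (p_ j)) (@Y (p_ j)) (nth 0 (f_ k x) j.-1))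
          | j <- iota 1 k].

(* Reads Hk_string as a vertex of Opt(G); nothing is cut off or padded, see
   size_Hk_string. *)
Definition Hk (x : grid) : cube (opt_dim grid) :=
  [tuple nth false (Hk_string x) i | i < opt_dim grid].

Lemma e_k_opt_dim : e_ k = opt_dim grid.
Proof.
rewrite /e_ /opt_dim card_dep_ffun foldrE big_map big_enum /=.
rewrite big_add1 /= big_mkord; congr (up_log _ _).
by apply: eq_bigr => i _; rewrite card_ord.
Qed.

Lemma size_Hk_string (x : grid) :
  (forall i, 1 <= i <= k -> 0 < a i) -> size (Hk_string x) = opt_dim grid.
Proof.
move=> a_gt0; rewrite -e_k_opt_dim /Hk_string size_flatten /shape -map_comp.
rewrite (@eq_map _ _ _ p_) => [|j]; last by rewrite /= size_tuple.
suff sum_p n : n <= k -> sumn [seq p_ j | j <- iota 1 n] = e_ n by exact: sum_p.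
elim: n => [|n IHn] le_nk; first by rewrite /= /e_ big_geq.
rewrite -(addn1 n) iotaD map_cat sumn_cat IHn ?(ltnW le_nk) //= addn0.
rewrite add1n addn1 /p_ subnKC //=; apply: leq_up_log.
by rewrite [leqRHS]big_nat_recr //= leq_pmulr // a_gt0.
Qed.

End Construction.

(* Main.v *)
Require Import Defs.
From mathcomp Require Import all_boot all_order all_algebra.
From mathcomp Require Import zify ring lra.

Set Implicit Arguments.
Unset Strict Implicit.
Unset Printing Implicit Defensive.

Import Order.TTheory GRing.Theory Num.Theory.

(** Write E = 2^(e_(i-1)), q = 2^(p_i) and A = a_1 ... a_i.  By the balance of
the rows of F(i), the z-th nonblank integer differs from E q z / A by a bounded
amount, and by the balance of its columns the stacking height of a point in the
r-th block differs from r A / (E q) by a bounded amount, whatever its residue.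
Hence, if along a grid edge of direction R the last entry of f_i changes by
a_1 ... a_(R-1) / E (by 0 if R <= i) up to an error of at most 5, then its
residue modulo q changes cyclically by at most 15, and the stacking heights
satisfy the same estimate for f_(i+1): the errors do not accumulate.  For f_2
the estimate holds because N_ij and c_ij are differences of values of the
Beatty sequence floor(2^(e_1) n / a_1).

Labels at cyclic distance at most 15 lie at or next to equal or consecutive
vertices of the cycle of Q_t, so they are joined by a path of length at most 3;
this gives the dilation.

Route an edge x y by correcting the blocks 1, ..., k in this order.  A cube edge
in block j then determines the labels of y in the blocks < j, the labels of x
in the blocks > j, and the label of x in block j up to 61 choices.  The labels
of x in the blocks >= j determine the last entry of f_j(x), which leaves 11
choices for the last entry of f_j(y), and then y is determined.  With k
directions this bounds the congestion by 671 k. *)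

(** * Chains and Beatty sequences *)

Section BeattyFloor.
Variables (b a : nat).
Hypothesis a_gt0 : 0 < a.
Local Open Scope ring_scope.

(** The argument is an integer, not a natural number, because the matrix R is read along its
    diagonals i - j, whose index becomes negative. *)
Definition beatty (n : int) : int := (b%:Z * n %/ a%:Z)%Z.

Lemma beatty_bounds n :
  beatty n * a%:Z <= b%:Z * n /\ b%:Z * n < beatty n * a%:Z + a%:Z.
Proof.
split; first by apply: lez_floor; lia.
have := @ltz_ceil (b%:Z * n) a%:Z _; rewrite /beatty; nia.
Qed.

(** This quasi-periodicity absorbs the reduction of row indices modulo a_1. *)
Lemma beatty_shift n : beatty (n + a%:Z) = beatty n + b%:Z.
Proof.
by rewrite /beatty mulrDr divzDr ?dvdz_mull // mulzK //; lia.
Qed.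

Hypothesis le_ab : (a <= b)%N.

Lemma beatty_nat (n : nat) : beatty n%:Z = n%:Z + ((b - a) * n %/ a)%N%:Z.
Proof.
rewrite /beatty -PoszM divz_nat.
have -> : (b * n = n * a + (b - a) * n)%N by nia.
by rewrite divnMDl.
Qed.

Hypothesis lt_b2a : (b < 2 * a)%N.

(** The slope b / a lies in [1, 2), so consecutive floors differ by 1 or 2; hence the entries of R
    are 0 or 1. *)
Lemma beatty_step n : beatty n + 1 <= beatty (n + 1) <= beatty n + 2.
Proof.
have [h1 h2] := beatty_bounds n; have [h3 h4] := beatty_bounds (n + 1).
nia.
Qed.

End BeattyFloor.

Section Chain.
Variable a : nat -> nat.
Let b := 2 ^ e_ a 1.
Let g := beatty b (a 1).
Hypotheses (a_gt0 : 0 < a 1) (le_ab : a 1 <= b) (lt_b2a : b < 2 * a 1).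

(** The first column of R is a difference of consecutive Beatty values minus 1, and the cyclic rule
    copies it along diagonals. *)
Lemma R_beatty i j : 1 <= i <= a 1 ->
  ((R_ a i j.+1)%:Z = g (i%:Z - j%:Z) - g (i%:Z - j%:Z - 1) - 1)%R.
Proof.
elim: j i => [|j IHj] i hi.
  rewrite /= /R1 -/b /g.
  have -> : (i%:Z - 0%:Z - 1 = i.-1%:Z)%R by lia.
  have -> : (i%:Z - 0%:Z = i%:Z)%R by lia.
  rewrite !beatty_nat //.
  have : (b - a 1) * i.-1 %/ a 1 <= (b - a 1) * i %/ a 1.
    by apply: leq_div2r; rewrite leq_mul2l leq_pred orbT.
  lia.
rewrite [LHS]/= IHj; last by case: eqP; lia.
(* Row 1 wraps around to row a_1; both Beatty values then shift by the same amount, so their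
   difference is preserved. *)
case: eqP => [->|ne1].
  have := @beatty_shift b _ a_gt0 (1%:Z - j.+1%:Z)%R.
  have := @beatty_shift b _ a_gt0 (1%:Z - j.+1%:Z - 1)%R.
  rewrite -/g.
  have -> : (1%:Z - j.+1%:Z + a 1 = (a 1)%:Z - j%:Z)%R by lia.
  have -> : (1%:Z - j.+1%:Z - 1 + a 1 = (a 1)%:Z - j%:Z - 1)%R by lia.
  lia.
by have -> : (i.-1%:Z - j%:Z = i%:Z - j.+1%:Z)%R by lia.
Qed.

Lemma N_S i j : N_ a i j.+1 = (N_ a i j + R_ a i j.+1).+1.
Proof. by rewrite /N_ big_nat_recr //=; lia. Qed.

Lemma c_S i j : c_ a i.+1 j = (c_ a i j + R_ a i.+1 j).+1.
Proof. by rewrite /c_ big_nat_recr //=; lia. Qed.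

(** Row sums of R telescope, as do its column sums in [c_beatty]; both quantities become differences
    of two floors, with error below 1. *)
Lemma N_beatty i j : 1 <= i <= a 1 ->
  ((N_ a i j)%:Z = g i%:Z - g (i%:Z - j%:Z))%R.
Proof.
move=> hi; elim: j => [|j IHj]; first by rewrite /N_ big_geq // subr0 subrr.
rewrite N_S; have := R_beatty j hi.
have -> : (i%:Z - j%:Z - 1 = i%:Z - j.+1%:Z)%R by lia.
lia.
Qed.

Lemma c_beatty i j : i <= a 1 ->
  ((c_ a i j.+1)%:Z = g (i%:Z - j%:Z) - g (- j%:Z))%R.
Proof.
elim: i => [|i IHi] hi; first by rewrite /c_ big_geq // sub0r subrr.
have {}IHi := IHi (ltnW hi).
rewrite c_S; have := @R_beatty i.+1 j hi.
have -> : (i.+1%:Z - j%:Z - 1 = i%:Z - j%:Z)%R by lia.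
lia.
Qed.

Lemma R_le1 i j : 1 <= i <= a 1 -> 1 <= j -> R_ a i j <= 1.
Proof.
case: j => // j hi _; have := R_beatty j hi.
have := beatty_step a_gt0 le_ab lt_b2a (i%:Z - j%:Z - 1)%R.
rewrite subrK -/g; lia.
Qed.

Lemma c_bound i j : i <= a 1 -> 1 <= j ->
  c_ a i j * a 1 < b * i + a 1 /\ b * i < c_ a i j * a 1 + a 1.
Proof.
case: j => // j hi _; have := c_beatty j hi.
have := beatty_bounds b a_gt0 (i%:Z - j%:Z)%R.
have := beatty_bounds b a_gt0 (- j%:Z)%R.
rewrite -/g; move: (g _) (g _) => u v [h1 h2] [h3 h4] h5.
(* Multiplying by a_1 produces the monomials that occur in the floor bounds, so that the goal is
   linear in them. *)
have h6 := congr1 (fun w : int => w * (a 1)%:Z)%R h5.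
split; lia.
Qed.

(** A column runs through one full period of the Beatty sequence, so each column receives exactly
    2^(e_1) points. *)
Lemma c_last j : 1 <= j -> c_ a (a 1) j = b.
Proof.
case: j => // j _; have := @c_beatty (a 1) j (leqnn _).
have := beatty_shift b a_gt0 (- j%:Z)%R.
by rewrite /g addrC; set u := beatty _ _ _; set v := beatty _ _ _; lia.
Qed.

Lemma c_0 j : c_ a 0 j = 0.
Proof. by rewrite /c_ big_geq. Qed.

Lemma N_bound i j : 1 <= i <= a 1 ->
  N_ a i j * a 1 < b * j + a 1 /\ b * j < N_ a i j * a 1 + a 1.
Proof.
move=> hi; have := N_beatty j hi.
have := beatty_bounds b a_gt0 (i%:Z - j%:Z)%R.
have := beatty_bounds b a_gt0 i%:Z.
rewrite -/g; move: (g _) (g _) => u v [h1 h2] [h3 h4] h5.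
have h6 := congr1 (fun w : int => w * (a 1)%:Z)%R h5.
split; lia.
Qed.

Lemma N_0 i : N_ a i 0 = 0.
Proof. by rewrite /N_ big_geq. Qed.

Lemma leq_N i j : j <= N_ a i j.
Proof. exact: leq_addr. Qed.

Lemma chain_colP i m : 1 <= m ->
  [/\ 1 <= chain_col a i m, N_ a i (chain_col a i m).-1 < m
    & m <= N_ a i (chain_col a i m)].
Proof.
move=> m_gt0; rewrite /chain_col.
set P := fun j => _; have hP : has P (iota 0 m.+1).
  (* The bounded search succeeds because j = m is a candidate: [N_ a i m] is at least m. *)
  by apply/hasP; exists m; rewrite ?mem_iota ?ltnSn // /P leq_N.
have := nth_find 0 hP; move: (hP); rewrite has_find size_iota => lt_find.
rewrite nth_iota // add0n {1}/P => hle; split=> //.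
  by case: find hle => //; rewrite N_0; lia.
case Ef: find hle => [|f] hle /=; first by rewrite N_0.
have : f < find P (iota 0 m.+1) by rewrite Ef.
move/(before_find 0); rewrite nth_iota ?add0n; last by rewrite -Ef ltnW.
by rewrite /P leqNgt => /negbFE.
Qed.

(** Exchanging the two images in even columns does not leave the interval between c_(i-1,j) and
    c_(i,j), so the parity of j is irrelevant here. *)
Lemma chain_rowP i m : 1 <= i <= a 1 -> 1 <= m ->
  c_ a i.-1 (chain a i m).2 < (chain a i m).1 <= c_ a i (chain a i m).2.
Proof.
move=> hi hm; have [h1 h2 h3] := chain_colP i hm.
rewrite /chain; move: (chain_col a i m) h1 h2 h3 => j h1 h2 h3.
have := R_le1 hi h1; have := @c_S i.-1 j; have -> : i.-1.+1 = i by lia.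
have := N_S i j.-1; have -> : j.-1.+1 = j by lia.
by case: eqP => ?; [|case: ifP => ?] => /=; lia.
Qed.

Lemma chain_col2 i m : (chain a i m).2 = chain_col a i m.
Proof. by rewrite /chain; do 2?case: ifP. Qed.

Lemma c_mono j i1 i2 : i1 <= i2 -> c_ a i1 j <= c_ a i2 j.
Proof.
elim: i2 => [|i2 IH]; first by rewrite leqn0 => /eqP->.
by rewrite c_S; case: (ltngtP i1 i2.+1) => // [|->]; rewrite ?c_S; lia.
Qed.

Lemma N_mono i j1 j2 : j1 <= j2 -> N_ a i j1 <= N_ a i j2.
Proof.
elim: j2 => [|j2 IH]; first by rewrite leqn0 => /eqP->.
by rewrite N_S; case: (ltngtP j1 j2.+1) => // [|->]; rewrite ?N_S; lia.
Qed.

Lemma chain_col_bounds i m : 1 <= i <= a 1 -> 1 <= m ->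
  [/\ 1 <= (chain a i m).2, b * (chain a i m).2.-1 < m * a 1
    & m * a 1 < b * (chain a i m).2 + a 1].
Proof.
move=> hi hm; rewrite chain_col2; have [h1 h2 h3] := chain_colP i hm.
move: (chain_col a i m) h1 h2 h3 => j h1 h2 h3; split=> //.
- have [_ l] := N_bound j.-1 hi; apply: leq_trans l _.
  by rewrite -mulSnr leq_mul2r h2 orbT.
- have [l _] := N_bound j hi; apply: leq_ltn_trans l.
  by rewrite leq_mul2r h3 orbT.
Qed.

Lemma chain_row_bounds i m : 1 <= i <= a 1 -> 1 <= m ->
  [/\ 1 <= (chain a i m).1 <= b, b * i.-1 < (chain a i m).1 * a 1
    & (chain a i m).1 * a 1 < b * i + a 1].
Proof.
move=> hi hm; have /andP[h2 h3] := chain_rowP hi hm.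
have [hj _ _] := chain_col_bounds hi hm.
move: (chain a i m).1 (chain a i m).2 h2 h3 hj => r j h2 h3 hj; split.
- rewrite (leq_ltn_trans _ h2) //= (leq_trans h3) // -(c_last hj) c_mono //; lia.
- have [|_ l] := @c_bound i.-1 j _ hj; first by lia.
  by apply: leq_trans l _; rewrite -mulSnr leq_mul2r h2 orbT.
- have [|l _] := @c_bound i j _ hj; first by lia.
  by apply: leq_ltn_trans l; rewrite leq_mul2r h3 orbT.
Qed.

(** For fixed j the intervals of [chain_rowP] are disjoint, so the image determines i; the offset
    inside the interval then determines m. *)
Lemma chain_inj i1 i2 m1 m2 :
  1 <= i1 <= a 1 -> 1 <= i2 <= a 1 -> 1 <= m1 -> 1 <= m2 ->
  chain a i1 m1 = chain a i2 m2 -> i1 = i2 /\ m1 = m2.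
Proof.
move=> hi1 hi2 hm1 hm2 eq_ch.
have r1 := chain_rowP hi1 hm1; have r2 := chain_rowP hi2 hm2.
rewrite -eq_ch in r2; have eq_i : i1 = i2.
  move: r1 r2; set j := (_).2 => r1 r2.
  by case: (ltngtP i1 i2) => // h;
    have := @c_mono j i1 i2.-1; have := @c_mono j i2 i1.-1; lia.
subst i2; split=> //.
have [h1 h2 h3] := chain_colP i1 hm1; have [g1 g2 g3] := chain_colP i1 hm2.
have eq_j : chain_col a i1 m1 = chain_col a i1 m2 by rewrite -!chain_col2 eq_ch.
move: eq_ch; rewrite /chain -eq_j; rewrite -eq_j in g1 g2 g3.
move: (chain_col a i1 m1) h1 h2 h3 g1 g2 g3 => j h1 h2 h3 g1 g2 g3.
have := R_le1 hi1 h1; have := N_S i1 j.-1; have -> : j.-1.+1 = j by lia.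
by case: eqP => ?; [|case: ifP => ?] => ? ? /(congr1 fst) /=; lia.
Qed.

(** The intervals of [chain_rowP] tile 1, ..., 2^(e_1) in every column. This makes the fibres of f_2
    over its first entry initial segments. *)
Lemma chain_surj r j : 1 <= r <= b -> 1 <= j ->
  exists i m, [/\ 1 <= i <= a 1, 1 <= m <= N_ a i j & chain a i m = (r, j)].
Proof.
move=> hr hj.
have [i hi hrow] : exists2 i, 1 <= i <= a 1 & c_ a i.-1 j < r <= c_ a i j.
  have ex : exists i, r <= c_ a i j by exists (a 1); rewrite c_last //; lia.
  case: (ex_minnP ex) => i hi1 hi2; exists i; last first.
    rewrite hi1 andbT; case: i hi1 hi2 => [|i] hi1 hi2; first by rewrite c_0; lia.
    by rewrite ltnNge; apply/negP => /hi2; rewrite ltnn.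
  rewrite hi2 ?c_last ?andbT; try lia.
  by case: i hi1 {hi2} => //; rewrite c_0; lia.
have hR := R_le1 hi hj; have hcS := @c_S i.-1 j.
have hNS := N_S i j.-1.
have e1 : i.-1.+1 = i by lia.
have e2 : j.-1.+1 = j by lia.
rewrite e1 in hcS; rewrite e2 in hNS.
have col d : 1 <= d <= (R_ a i j).+1 -> chain_col a i (N_ a i j.-1 + d) = j.
  move=> hd; have hm : 1 <= N_ a i j.-1 + d by lia.
  have [h1 h2 h3] := chain_colP i hm.
  have mono := @N_mono i.
  case: (ltngtP (chain_col a i (N_ a i j.-1 + d)) j) => // h.
    by have := mono _ j.-1 _; move/(_ (chain_col a i (N_ a i j.-1 + d))); lia.
  by have := mono j _ _; move/(_ (chain_col a i (N_ a i j.-1 + d)).-1); lia.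
(* The exchange of offsets 1 and 2 is the involution sending d to 3 - d, so the same formula inverts
   it. *)
pose d0 := r - c_ a i.-1 j.
pose d := if R_ a i j == 0 then 1 else if odd j then d0 else 3 - d0.
have hd : 1 <= d <= (R_ a i j).+1.
  by rewrite /d /d0; case: eqP => ?; [|case: ifP => ?]; lia.
exists i, (N_ a i j.-1 + d); split=> //; first by lia.
rewrite /chain col //; rewrite addKn /d /d0.
by case: eqP => hR0; [|case: (boolP (odd j)) => ho]; congr pair; lia.
Qed.

End Chain.

(** * Balanced roundings *)

Definition row_count (F : nat -> nat -> bool) c b :=
  \sum_(1 <= d < b.+1) ~~ F c d.
Definition col_count (F : nat -> nat -> bool) b d :=
  \sum_(1 <= c < b.+1) ~~ F c d.

Lemma row_count_S F c b : row_count F c b.+1 = row_count F c b + ~~ F c b.+1.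
Proof. by rewrite /row_count big_nat_recr. Qed.

Lemma col_count_S F b d : col_count F b.+1 d = col_count F b d + ~~ F b.+1 d.
Proof. by rewrite /col_count big_nat_recr. Qed.

(** Clears the denominator, turning a balance condition over the rationals into two inequalities
    between natural numbers. *)
Lemma nat_dist_lt1 (q x y : nat) : 0 < q ->
  (`|x%:R - y%:R / q%:R| < 1 :> rat)%R -> y < q * x + q /\ q * x < y + q.
Proof.
move=> q_gt0; have q0 : (0 < q%:R :> rat)%R by rewrite ltr0n.
have -> : (x%:R - y%:R / q%:R = ((q * x)%N%:R - y%:R) / q%:R :> rat)%R.
  by rewrite mulrBl natrM mulrAC divff ?mul1r // gt_eqF.
rewrite normrM normfV (gtr0_norm q0) ltr_pdivrMr // mul1r ltr_norml.
by move=> /andP[h1 h2]; split; rewrite -(ltr_nat rat) natrD; lra.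
Qed.

Section Rounding.
Variables (k : nat) (a : nat -> nat) (i : nat) (F : nat -> nat -> bool).
Let A := \prod_(1 <= j < i.+1) a j.
Let E := 2 ^ e_ a i.-1.
Let q := 2 ^ p_ a i.

(** This is the ceiling of c A / E. It will be the number of nonblank integers in the first c
    levels. *)
Definition ceil_level (c : nat) := (c * A + E.-1) %/ E.
Local Notation h := ceil_level.

Let E_gt0 : 0 < E. Proof. by rewrite expn_gt0. Qed.
Let q_gt0 : 0 < q. Proof. by rewrite expn_gt0. Qed.

Lemma ceil_level_bounds c : c * A <= E * h c < c * A + E.
Proof.
have E0 := E_gt0; rewrite /h.
have := divn_eq (c * A + E.-1) E; have := ltn_pmod (c * A + E.-1) E0.
set u := _ %/ _; set v := _ %% _; rewrite mulnC; lia.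
Qed.

Lemma ceil_level0 : h 0 = 0.
Proof. have := ceil_level_bounds 0; have := E_gt0; nia. Qed.

Lemma ceil_level_mono c : h c.-1 <= h c.
Proof.
by apply: leq_div2r; rewrite leq_add2r leq_mul2r leq_pred orbT.
Qed.

Local Open Scope ring_scope.

Lemma ceil_alpha (c : nat) : Num.ceil (c%:R * alpha a i) = (h c)%:Z.
Proof.
have E0 : (0 : rat) < E%:R by rewrite ltr0n E_gt0.
apply: ceil_def; rewrite /alpha -/A -/E mulrA ltr_pdivlMr // ler_pdivrMr //.
have /andP[h1 h2] := ceil_level_bounds c.
rewrite intrB -pmulrn -!natrM ler_nat (mulnC (h c)) h1 andbT.
rewrite mulrBl mul1r ltrBlDr -natrM -natrD ltr_nat mulnC; lia.
Qed.

(** Since phi is ceil(alpha) - alpha, floor(m phi) equals m ceil(alpha) - ceil(m alpha); the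
    difference of two such floors leaves [h c - h c.-1] nonblanks in level c. *)
Lemma s_ceil_level (c : nat) : (0 < c)%N ->
  s_ a i c = q%:Z - (h c - h c.-1)%N%:Z.
Proof.
move=> c0; rewrite /s_ -/q.
have fl (m : nat) : Num.floor (m%:R * phi a i) =
    m%:Z * Num.ceil (alpha a i) - (h m)%:Z.
  rewrite -ceil_alpha floorNceil /phi.
  have -> : - (m%:R * ((Num.ceil (alpha a i))%:~R - alpha a i)) =
      m%:R * alpha a i + (- (m%:Z * Num.ceil (alpha a i)))%:~R.
    rewrite intrN intrM -pmulrn; ring.
  by rewrite ceilDrz ?intr_int // intrKceil; set u := Num.ceil _; set v := Num.ceil _; lia.
rewrite !fl; case: c c0 => // c _ /=; have := ceil_level_mono c.+1.
rewrite /=; lia.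
Qed.

Hypothesis Fround : blank_rounding k a i F.

Let term c d : (0 < c)%N ->
  T_ a i c d - (F c d)%:R =
  (~~ F c d)%:R - (h c - h c.-1)%N%:R / q%:R.
Proof.
move=> c0; have q0 : q%:R != 0 :> rat by rewrite pnatr_eq0 -lt0n q_gt0.
rewrite /T_ s_ceil_level // -/q intrB -!pmulrn mulrBl divff //.
by case: (F c d) => /=; ring.
Qed.

Lemma row_count_bounds c b :
  (1 <= c <= P_ k a i)%N -> (1 <= b <= q)%N ->
  (b * (h c - h c.-1) < q * row_count F c b + q /\
   q * row_count F c b < b * (h c - h c.-1) + q)%N.
Proof.
move=> hc hb; case: Fround => _ /(_ c b hc hb) + _ _.
rewrite (eq_bigr _ (fun d _ => term d _)); last by case/andP: hc.
rewrite sumrB -natr_sum -/(row_count F c b) sumr_const_nat subn1 /=.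
rewrite -[X in _ - X]mulr_natl mulrA -natrM; apply: nat_dist_lt1.
exact: q_gt0.
Qed.

(** The row densities telescope to h b / q, which does not involve d: stacking heights are nearly
    the same over all residues. *)
Lemma col_count_bounds d b :
  (1 <= d <= q)%N -> (1 <= b <= P_ k a i)%N ->
  (h b < q * col_count F b d + q /\
   q * col_count F b d < h b + q)%N.
Proof.
move=> hd hb; case: Fround => _ _ /(_ d b hd hb) + _.
suff -> : \sum_(1 <= c < b.+1) (T_ a i c d - (F c d)%:R) =
    (col_count F b d)%:R - (h b)%:R / q%:R :> rat.
  by apply: nat_dist_lt1; apply: q_gt0.
elim: b {hb} => [|b IHb].
  by rewrite /col_count !big_geq // ceil_level0 mul0r subrr.
rewrite col_count_S big_nat_recr //= natrD IHb term //.
have := ceil_level_mono b.+1; rewrite /= => hm.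
rewrite natrB //; ring.
Qed.

End Rounding.

(** * Positions of nonblank integers and stacking heights *)

Lemma iota1S m : iota 1 m.+1 = iota 1 m ++ [:: m.+1].
Proof. by rewrite -(addn1 m) iotaD add1n addn1. Qed.

Section FilterIota.
Variable p : pred nat.

(** Together with [nth_filter_iotaK]: taking the z-th selected integer and counting selected
    integers up to m are mutually inverse. *)
Lemma nth_filter_iotaP N z : 1 <= z <= count p (iota 1 N) ->
  let m := nth 0 [seq j <- iota 1 N | p j] z.-1 in
  [/\ 1 <= m <= N, p m & count p (iota 1 m) = z].
Proof.
elim: N => [|N IHN]; first by rewrite /=; lia.
rewrite -(addn1 N) iotaD count_cat filter_cat nth_cat size_filter /= addn0 => hz.
change (count [eta p]) with (count p); case: (ltnP z.-1 (count p _)) => [lt_z|le_z].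
  by have [|h1 h2 h3] := IHN; [lia | split=> //; lia].
move: hz; rewrite add1n; case: ifP => pN /= hz; last by lia.
have -> : z.-1 - count p (iota 1 N) = 0 by lia.
rewrite [nth _ _ _]/=; split; rewrite ?pN //; first by lia.
by rewrite iota1S count_cat /= pN; lia.
Qed.

Lemma nth_filter_iotaK N m : 1 <= m <= N -> p m ->
  nth 0 [seq j <- iota 1 N | p j] (count p (iota 1 m)).-1 = m.
Proof.
case: m => // m /andP[_ hm] pm.
have -> : N = m + (N - m.+1).+1 by lia.
rewrite iotaD filter_cat nth_cat size_filter iota1S count_cat /= add1n pm.
by rewrite addn0 addn1 ltnn subnn.
Qed.

Lemma leq_count_iota m n : m <= n -> count p (iota 1 m) <= count p (iota 1 n).
Proof. by move=> /subnKC<-; rewrite iotaD count_cat leq_addr. Qed.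

End FilterIota.

Section Levels.
Variables (q P : nat) (F : nat -> nat -> bool).
Hypothesis q_gt0 : 0 < q.

Definition rowof m := (m.-1 %/ q).+1.
Definition resid m := (m.-1 %% q).+1.
Definition nonblank m := ~~ F (rowof m) (resid m).
Definition pos z := nth 0 [seq m <- iota 1 (P * q) | nonblank m] z.-1.
Definition digit z := resid (pos z).
(** The height is a plain column count, with no reference to the image of f_i; [stack_top]
    identifies it with the count n_y of the construction. *)
Definition level z := col_count F (rowof (pos z)) (digit z).

Lemma rowofE r d : 1 <= r -> 1 <= d <= q -> rowof (r.-1 * q + d) = r.
Proof.
case: d => // d hr hd; rewrite /rowof addnS /= divnMDl // divn_small; lia.
Qed.

Lemma residE r d : 1 <= d <= q -> resid (r * q + d) = d.
Proof. by case: d => // d hd; rewrite /resid addnS /= modnMDl modn_small. Qed.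

Lemma row_resid m : 1 <= m -> m = (rowof m).-1 * q + resid m.
Proof.
by move=> hm; rewrite /rowof /resid /= addnS -divn_eq prednK.
Qed.

Lemma resid_bounds m : 1 <= resid m <= q.
Proof. by rewrite /resid /= ltn_pmod. Qed.

Lemma rowof_bounds m : 1 <= m <= P * q -> 1 <= rowof m <= P.
Proof.
move=> hm; rewrite /rowof /= ltn_divLR //; lia.
Qed.

Lemma col_count_mono r1 r2 d : r1 <= r2 -> col_count F r1 d <= col_count F r2 d.
Proof.
elim: r2 => [|r2 IH]; first by rewrite leqn0 => /eqP->.
by rewrite col_count_S; case: (ltngtP r1 r2.+1) => // [|->]; rewrite ?col_count_S; lia.
Qed.

(** A column count strictly increases at every nonblank entry. *)
Lemma col_count_inj r1 r2 d : 1 <= r1 -> 1 <= r2 -> ~~ F r1 d -> ~~ F r2 d ->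
  col_count F r1 d = col_count F r2 d -> r1 = r2.
Proof.
case: r1 r2 => [|r1] [|r2] // _ _ h1 h2; case: (ltngtP r1 r2) => [h|h|->] //.
  have := @col_count_mono r1.+1 r2 d h.
  by rewrite (col_count_S F r2 d) h2 => /= ? ?; lia.
have := @col_count_mono r2.+1 r1 d h.
by rewrite (col_count_S F r1 d) h1 => /= ? ?; lia.
Qed.

Lemma col_count_ivt r d w : 1 <= w <= col_count F r d ->
  exists r', [/\ 1 <= r' <= r, ~~ F r' d & col_count F r' d = w].
Proof.
elim: r => [|r IHr]; first by rewrite /col_count big_geq //; lia.
case: (leqP w (col_count F r d)) => hw.
  case/andP=> w0 _; have [|r' [h1 h2 h3]] := IHr; first by rewrite w0.
  by exists r'; split=> //; lia.
by rewrite col_count_S => hw2; exists r.+1; rewrite col_count_S;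
  case: (F r.+1 d) hw2 => /= hw2; split=> //; lia.
Qed.

Variable h : nat -> nat.
Hypotheses (h0 : h 0 = 0) (h_mono : forall c, h c.-1 <= h c).
Hypothesis row_bounds : forall c b, 1 <= c <= P -> 1 <= b <= q ->
  b * (h c - h c.-1) < q * row_count F c b + q /\
  q * row_count F c b < b * (h c - h c.-1) + q.

Lemma h_mono2 c1 c2 : c1 <= c2 -> h c1 <= h c2.
Proof.
elim: c2 => [|c2 IH]; first by rewrite leqn0 => /eqP->.
by have := h_mono c2.+1 => /=; case: (ltngtP c1 c2.+1) => // [|->]; lia.
Qed.

(** At b = q the row estimate compares two integers at distance less than 1. *)
Lemma row_count_full c : 1 <= c <= P -> row_count F c q = h c - h c.-1.
Proof.
move=> hc; have [|h1 h2] := @row_bounds c q hc; first by lia.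
move: h1 h2; set x := _ - _; set y := row_count _ _ _ => h1 h2.
have g1 : x < y.+1 by rewrite -(ltn_pmul2l q_gt0) mulnS; lia.
have g2 : y < x.+1 by rewrite -(ltn_pmul2l q_gt0) mulnS; lia.
lia.
Qed.

Lemma count_row r d : 1 <= r -> d <= q ->
  count nonblank (iota (r.-1 * q).+1 d) = row_count F r d.
Proof.
move=> hr; elim: d => [|d IHd] hd; first by rewrite /row_count big_geq.
rewrite -(addn1 d) iotaD count_cat IHd /= ?addn0 ?addn1 ?row_count_S; last by lia.
rewrite addSn -addnS /nonblank rowofE ?residE //; lia.
Qed.

Lemma count_nonblank r d : 1 <= r <= P -> d <= q ->
  count nonblank (iota 1 (r.-1 * q + d)) = h r.-1 + row_count F r d.
Proof.
move=> hr hd; rewrite iotaD count_cat add1n count_row //; last by lia.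
congr addn; case: r hr => // r /= hr; elim: r hr => [|r IHr] hr.
  by rewrite mul0n h0.
rewrite mulSn addnC iotaD count_cat add1n IHr; last by lia.
rewrite (@count_row r.+1) // row_count_full /=; last by lia.
by have := h_mono r.+1 => /=; lia.
Qed.

Lemma count_all : count nonblank (iota 1 (P * q)) = h P.
Proof.
case: P row_count_full count_nonblank => [|P'] rc cn; first by rewrite h0.
have -> : P'.+1 * q = P'.+1.-1 * q + q by rewrite /=; lia.
rewrite cn ?leqnn // rc ?leqnn //=; have := h_mono P'.+1; rewrite /=; lia.
Qed.

Lemma posP z : 1 <= z <= h P ->
  [/\ 1 <= pos z <= P * q, nonblank (pos z)
    & count nonblank (iota 1 (pos z)) = z].
Proof. by rewrite -count_all => /nth_filter_iotaP. Qed.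

Lemma pos_count m : 1 <= m <= P * q -> nonblank m ->
  pos (count nonblank (iota 1 m)) = m.
Proof. exact: nth_filter_iotaK. Qed.

Lemma digit_bounds z : 1 <= digit z <= q.
Proof. exact: resid_bounds. Qed.

Lemma digit_level_inj z1 z2 : 1 <= z1 <= h P -> 1 <= z2 <= h P ->
  digit z1 = digit z2 -> level z1 = level z2 -> z1 = z2.
Proof.
move=> hz1 hz2; have [b1 nb1 e1] := posP hz1; have [b2 nb2 e2] := posP hz2.
rewrite /level => ed; rewrite -ed => /col_count_inj er.
have {}er : rowof (pos z1) = rowof (pos z2).
  by apply: er => //; rewrite ?ed.
rewrite -e1 -e2; have -> // : pos z1 = pos z2.
rewrite [LHS]row_resid; last by lia.
by rewrite [RHS]row_resid; [rewrite er; congr addn | lia].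
Qed.

Lemma level_gt0 z : 1 <= z <= h P -> 1 <= level z.
Proof.
move=> hz; have [b1 nb1 e1] := posP hz.
by move: nb1; rewrite /level /nonblank -/(digit z) /rowof col_count_S => ->; rewrite addn1.
Qed.

(** A nonblank entry in the same column and no higher row is the position of some z' at most z,
    because positions increase with z. *)
Lemma pos_below z r : 1 <= z <= h P -> 1 <= r <= rowof (pos z) ->
  ~~ F r (digit z) ->
  exists2 z', 1 <= z' <= z & pos z' = r.-1 * q + digit z.
Proof.
move=> hz hr nbr; have [b1 nb1 e1] := posP hz.
have db := digit_bounds z; have rb := rowof_bounds b1.
pose m := r.-1 * q + digit z.
have rm : rowof m = r by apply: rowofE => //; lia.
have dm : resid m = digit z by apply: residE.
have hm : m <= pos z.
  rewrite (@row_resid (pos z)) ?leq_add2r ?leq_mul2r; last by lia.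
  by apply/orP; right; move: hr; rewrite /rowof /=; lia.
have nbm : nonblank m by rewrite /nonblank rm dm.
have m1 : 1 <= m <= P * q.
  rewrite (leq_trans hm) ?andbT; last by case/andP: b1.
  by rewrite addn_gt0 orbC; case/andP: db => ->.
exists (count nonblank (iota 1 m)); last exact: pos_count.
rewrite -[X in _ <= _ <= X]e1 leq_count_iota // andbT.
rewrite -has_count; apply/hasP; exists m => //; rewrite mem_iota; lia.
Qed.

(** Column counts grow by unit steps, so every smaller height occurs over the same residue. This
    passes the initial-segment property on to the next map. *)
Lemma level_fibre z w : 1 <= z <= h P -> 1 <= w <= level z ->
  exists z', [/\ 1 <= z' <= z, digit z' = digit z & level z' = w].
Proof.
move=> hz /col_count_ivt[r [hr nbr er]].
have [z' hz' ez'] := pos_below hz hr nbr; exists z'.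
have db := digit_bounds z; have r0 : 1 <= r by case/andP: hr.
have dz' : digit z' = digit z by rewrite {1}/digit ez' residE.
by split=> //; rewrite /level dz' ez' rowofE.
Qed.

Lemma mod_resid m1 m2 : 1 <= m1 -> 1 <= m2 ->
  (m1 == m2 %[mod q]) = (resid m1 == resid m2).
Proof.
case: m1 m2 => [|m1] [|m2] // _ _.
by rewrite /resid /= eqSS -(addn1 m1) -(addn1 m2) eqn_modDr.
Qed.

Lemma leq_rowof m r : 1 <= m -> (m <= r * q) = (rowof m <= r).
Proof. by case: m => // m _; rewrite /rowof /= ltn_divLR. Qed.

Hypothesis col_bounds : forall d b, 1 <= d <= q -> 1 <= b <= P ->
  h b < q * col_count F b d + q /\ q * col_count F b d < h b + q.

Lemma level_ceil z : 1 <= z <= h P -> q * (level z).-1 < h P.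
Proof.
move=> hz; have [b1 nb1 e1] := posP hz; have lz := level_gt0 hz.
have db := digit_bounds z; have rb := rowof_bounds b1.
have [c1 c2] := col_bounds db rb.
have : h (rowof (pos z)) <= h P by apply: h_mono2; case/andP: rb.
move: lz; rewrite /level; case: (col_count _ _ _) c1 c2 => // l c1 c2 _ /=.
lia.
Qed.

Variables (A E : nat).
Hypotheses (E_gt0 : 0 < E) (le_A : A <= E * q) (lt_A : E * q < 2 * A).
Hypothesis h_bounds : forall c, c * A <= E * h c < c * A + E.

(* The z-th nonblank integer lies at E q / A times z, up to a bounded error:
   both row estimates are used, at d and at d - 1, since d itself is nonblank. *)
Lemma pos_bounds z : 1 <= z <= h P ->
  A * pos z < E * q * z + E * q /\ E * q * z < A * pos z + 2 * (E * q).
Proof.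
move=> hz; have [b1 nb1 e1] := posP hz.
have db := resid_bounds (pos z); have rb := rowof_bounds b1.
rewrite (@row_resid (pos z)); last by lia.
move: e1 nb1; rewrite {1}(@row_resid (pos z)); last by lia.
rewrite /nonblank.
move: (rowof _) (resid _) db rb => r d db rb.
rewrite count_nonblank //; last by lia.
case: r rb => // r rb /= ez nb.
have [l1 l2] := @row_bounds r.+1 d rb db.
have hr := h_mono r.+1.
have /andP[x1 x2] := h_bounds r; have /andP[x3 x4] := h_bounds r.+1.
move: l1 l2 hr; rewrite /= => l1 l2 hr.
have l3 : d.-1 * (h r.+1 - h r) < q * row_count F r.+1 d.
  case: d db nb {l1 l2 ez} => // d db nb; rewrite /= row_count_S nb.
  case: d db {nb} => [|d] db; first by lia.
  have [|k1 k2] := @row_bounds r.+1 d.+1 rb; first by lia.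
  by move: k1 => /=; lia.
(* [e0] and [e1] are the excesses of E h over r A and (r + 1) A, each at most E. The facts named f1
   to f9 supply the products that [lia] treats as atoms. *)
have [e0 E0] : exists e0, E * h r = r * A + e0 by exists (E * h r - r * A); lia.
have [nu Enu] : exists nu, h r.+1 = h r + nu by exists (h r.+1 - h r); lia.
rewrite Enu addKn in l1 l2 l3 x3 x4.
have [e1 E1] : exists e1, E * nu + e0 = A + e1.
  by exists (E * nu + e0 - A); lia.
have lt_e0 : e0 <= E by lia.
have lt_e1 : e1 <= E by lia.
rewrite -ez; case: d db l3 l2 {l1 nb ez} => // d db l3 l2.
move: (row_count F r.+1 d.+1) l2 l3 => v l2 l3.
have [c qE] : exists c, q = c + d.+1 by exists (q - d.+1); lia.
have f1 : E * (q * v) < E * (d.+1 * nu + q) by rewrite ltn_pmul2l.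
have f2 : E * (d * nu) < E * (q * v) by rewrite ltn_pmul2l.
have f3 : d * (E * nu + e0) = d * (A + e1) by rewrite E1.
have f3' : d.+1 * (E * nu + e0) = d.+1 * (A + e1) by rewrite E1.
have f4 : q * (E * h r) = q * (r * A + e0) by rewrite E0.
have f5 : c * e0 <= c * E by rewrite leq_mul2l lt_e0 orbT.
have f6 : d.+1 * e1 <= d.+1 * E by rewrite leq_mul2l lt_e1 orbT.
have f7 := leq0n (c * e0); have f8 := leq0n (d * e1).
have f9 := le_A; rewrite qE in f1 f2 f4 f9 *.
clear l2 l3 x1 x2 x3 x4 lt_e0 lt_e1 E0 E1 Enu.
by split; lia.
Qed.

(** The lower bound applies the column estimate one row earlier and adds 1, since the entry at
    [pos z] itself is nonblank. *)
Lemma level_bounds z : 1 <= z <= h P ->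
  (rowof (pos z)).-1 * A < E * q * level z /\
  E * q * level z < rowof (pos z) * A + E + E * q.
Proof.
move=> hz; have [b1 nb1 e1] := posP hz; have lz := level_gt0 hz.
have db := digit_bounds z; have rb := rowof_bounds b1.
move: nb1 lz; rewrite /level /nonblank -/(digit z).
move: (rowof _) (digit z) db rb => r d db rb nb lz.
have [c1 c2] := col_bounds db rb.
have /andP[x3 x4] := h_bounds r.
split; last by nia.
case: r {c1 c2 x3 x4} rb nb lz => [|[|r]] // rb nb lz; first by nia.
have [|c1 c2] := @col_bounds d r.+1 db; first by lia.
have /andP[x1 x2] := h_bounds r.+1.
by rewrite col_count_S nb /=; nia.
Qed.

(** The inductive step: the hypothesis allows error 5 at one stage, and the conclusion returns error
    4 at the next, whatever the stage. *)
Lemma level_close z1 z2 m : 16 <= q -> 1 <= z1 <= h P -> 1 <= z2 <= h P ->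
  (`|E%:Z * (z2%:Z - z1%:Z) - m%:Z * A%:Z| <= 5 * E%:Z)%R ->
  (exists s : int, `|(digit z2)%:Z - (digit z1)%:Z + s * q%:Z| <= 15)%R /\
  (`|(E * q)%N%:Z * ((level z2)%:Z - (level z1)%:Z) - m%:Z * A%:Z|
     <= 4 * (E * q)%N%:Z)%R.
Proof.
move=> q16 hz1 hz2 hd.
have [a1 a2] := pos_bounds hz1; have [b1 b2] := pos_bounds hz2.
(* The hypothesis contributes 5 E q and [pos_bounds] contributes 3 E q; the total 8 E q is below 16
   A because E q < 2 A. *)
have hp : (`|(pos z2)%:Z - (pos z1)%:Z - m%:Z * q%:Z| <= 15)%R.
  set w := (_ - _ - _)%R.
  have h1 : (q%:Z * (E%:Z * (z2%:Z - z1%:Z) - m%:Z * A%:Z) <= q%:Z * (5 * E%:Z))%R.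
    by apply: ler_wpM2l; lia.
  have h2 : (q%:Z * - (5 * E%:Z) <= q%:Z * (E%:Z * (z2%:Z - z1%:Z) - m%:Z * A%:Z))%R.
    by apply: ler_wpM2l; lia.
  have h3 : (A%:Z * w < A%:Z * 16)%R by rewrite /w; lia.
  have h4 : (A%:Z * -16 < A%:Z * w)%R by rewrite /w; lia.
  have A0 : (0 < A%:Z)%R by lia.
  by move: h3 h4; rewrite !ltr_pM2l //; lia.
have [g1 g2] := level_bounds hz1; have [k1 k2] := level_bounds hz2.
have [p1 _ _] := posP hz1; have [p2 _ _] := posP hz2.
have r1 := @row_resid (pos z1); have r2 := @row_resid (pos z2).
have rr1 := rowof_bounds p1; have rr2 := rowof_bounds p2.
have d1 := digit_bounds z1; have d2 := digit_bounds z2.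
rewrite -/(digit z1) in r1; rewrite -/(digit z2) in r2.
move: (rowof (pos z1)) (rowof (pos z2)) g1 g2 k1 k2 r1 r2 rr1 rr2.
move=> r1 r2 g1 g2 k1 k2 e1 e2 rr1 rr2.
have {}e1 : pos z1 = r1.-1 * q + digit z1 by apply: e1; lia.
have {}e2 : pos z2 = r2.-1 * q + digit z2 by apply: e2; lia.
rewrite {}e1 {}e2 in hp.
case: r1 g1 g2 rr1 hp => // r1 g1 g2 _; case: r2 k1 k2 rr2 => // r2 k1 k2 _ hp.
rewrite /= in g1 k1 hp; pose t := (r2%:Z - r1%:Z - m%:Z)%R.
have ht : (`|(digit z2)%:Z - (digit z1)%:Z + t * q%:Z| <= 15)%R.
  by move: hp; rewrite /t; lia.
split; first by exists t.
(* Residues differ by less than q and 15 < q, so t q is below 2 q in absolute value: at most one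
   wrap-around occurs. *)
have tb : (-2 < t < 2)%R.
  have q0 : (0 < q%:Z)%R by lia.
  by rewrite -(ltr_pM2r q0) -(ltr_pM2r q0 t); lia.
have tA : (`|t * A%:Z| <= A%:Z)%R.
  have [->|[->|->]] : (t = -1 \/ t = 0 \/ t = 1)%R by lia.
  - by lia.
  - by lia.
  - by lia.
have EEq : E <= E * q by rewrite leq_pmulr.
move: (level z1) (level z2) g1 g2 k1 k2 tA; rewrite /t => l1 l2 g1 g2 k1 k2 tA.
clear - g1 g2 k1 k2 tA EEq le_A.
move: (E * q) g1 g2 k1 k2 EEq le_A => Q; lia.
Qed.

End Levels.

(** * Grids in mixed radix *)

Section Grid.
Variables (k : nat) (a : nat -> nat).
Hypothesis k2 : 2 <= k.
Hypothesis a_large : forall i, 1 <= i <= k -> 2 ^ 22 <= a i.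
Local Notation grid := (grid k a).
Local Notation coord := Defs.coord.
Implicit Types x y : grid.

Lemma length_gt0 i : 1 <= i <= k -> 0 < a i.
Proof. by move/a_large; apply: leq_trans; rewrite expn_gt0. Qed.

Definition volume i := \prod_(1 <= j < i.+1) a j.

Lemma volumeS i : volume i.+1 = volume i * a i.+1.
Proof. by rewrite /volume big_nat_recr. Qed.

Lemma volume_gt0 i : i <= k -> 0 < volume i.
Proof.
elim: i => [|i IHi] hi; first by rewrite /volume big_geq.
by rewrite volumeS muln_gt0 IHi ?(ltnW hi) // length_gt0.
Qed.

Lemma volume_e i : i <= k -> volume i <= 2 ^ e_ a i < 2 * volume i.
Proof.
move=> hi; have v0 := volume_gt0 hi.
rewrite /e_ -/(volume i); case: (ltngtP 1 (volume i)) => hv; first 1 last.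
- lia.
- by rewrite -hv.
have /andP[h1 ->] := up_log_bounds (isT : 1 < 2) hv.
rewrite /= -{1}(prednK (_ : 0 < up_log 2 (volume i))) ?expnS ?ltn_pmul2l //.
by rewrite up_log_gt0.
Qed.

(** Rounding up to a power of 2 loses a factor below 2, so 2^(22 + e_i) < 2^(e_(i+1) + 1), and
    integrality of the exponents gives the claim. *)
Lemma e_mono i : i < k -> 22 + e_ a i <= e_ a i.+1.
Proof.
move=> hi; have /andP[_ h2] := volume_e (ltnW hi).
have /andP[h3 _] := volume_e hi.
have h5 : 2 ^ 22 * volume i <= volume i.+1.
  by rewrite volumeS mulnC leq_mul2l a_large ?orbT.
rewrite -ltnS -(@ltn_exp2l 2) // expnD (expnS 2 (e_ a i.+1)).
apply: (@leq_trans (2 ^ 22 * (2 * volume i))).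
  by rewrite ltn_pmul2l // expn_gt0.
by rewrite mulnCA leq_pmul2l // (leq_trans h5 h3).
Qed.

Lemma p_ge22 i : 1 <= i <= k -> 22 <= p_ a i.
Proof. by case: i => // i /e_mono /=; rewrite /p_ /=; lia. Qed.

Definition side i := 2 ^ p_ a i.

Lemma e_side i : 1 <= i <= k -> 2 ^ e_ a i.-1 * side i = 2 ^ e_ a i.
Proof.
case: i => // i /= hi; rewrite -expnD /p_ subnKC //=.
by have := e_mono hi; lia.
Qed.

Lemma side_gt0 i : 0 < side i.
Proof. by rewrite expn_gt0. Qed.

Lemma side_ge i : 1 <= i <= k -> 16 * 4 <= side i.
Proof.
move=> /p_ge22 h; rewrite /side -(subnKC h) expnD.
apply: leq_trans (leq_pmulr _ _); last by rewrite expn_gt0.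
by rewrite (_ : 16 * 4 = 2 ^ 6) ?leq_exp2l.
Qed.

Lemma volume_P i : i <= k -> volume i * P_ k a i = volume k.
Proof.
move=> hi; rewrite /volume /P_ -big_cat_nat //; lia.
Qed.

Lemma coord_bounds x j : 1 <= j <= k -> 1 <= coord x j <= a j.
Proof.
move=> hj; rewrite /coord; case: insubP => [i _ ei|]; last by lia.
have ej : j = i.+1 by rewrite ei prednK //; lia.
by rewrite ej; apply: ltn_ord.
Qed.

Lemma coordE x (i : 'I_k) : coord x i.+1 = (x i).+1.
Proof.
rewrite /coord /=; case: insubP => [j _ ej|]; last by rewrite ltn_ord.
by have -> : j = i by apply/val_inj.
Qed.

Lemma coord_inj x y :
  (forall j, 1 <= j <= k -> coord x j = coord y j) -> x = y.
Proof.
move=> eq_c; apply/ffunP => i; apply/val_inj.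
by have := eq_c i.+1 (ltn_ord i); rewrite !coordE => /succn_inj.
Qed.

Definition weight R := \prod_(2 <= l < R) a l.

Lemma weight2 : weight 2 = 1.
Proof. by rewrite /weight big_geq. Qed.

Lemma weightS n : 2 <= n -> weight n.+1 = weight n * a n.
Proof. by move=> hn; rewrite /weight big_nat_recr. Qed.

Lemma flatE x : flat x = (\sum_(2 <= j < k.+1) (coord x j).-1 * weight j).+1.
Proof.
rewrite /flat [in RHS]big_ltn // weight2 muln1 -addSn prednK //.
by have /andP[] := @coord_bounds x 2 k2.
Qed.

Lemma digit_sum_lt (d : nat -> nat) n : 1 <= n <= k ->
  (forall j, 2 <= j <= n -> d j < a j) ->
  \sum_(2 <= j < n.+1) d j * weight j < weight n.+1.
Proof.
elim: n => // n IHn hn hd; case: (ltngtP n 0) => // [n0|n0]; last first.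
  by rewrite n0 big_geq // /weight big_geq.
rewrite big_nat_recr //= (@weightS n.+1) //.
have {}IH : \sum_(2 <= j < n.+1) d j * weight j < weight n.+1.
  by apply: IHn; [lia | move=> j hj; apply: hd; lia].
have lt_d : d n.+1 < a n.+1 by apply: hd; lia.
apply: (@leq_trans (weight n.+1 * (d n.+1).+1)); last by rewrite leq_mul2l lt_d orbT.
by rewrite mulnS mulnC ltn_add2r.
Qed.

(** The leading digit is the quotient by its weight, the lower digits summing to less than that
    weight by [digit_sum_lt]. *)
Lemma digit_sum_inj (d d' : nat -> nat) n : 1 <= n <= k ->
  (forall j, 2 <= j <= n -> d j < a j) ->
  (forall j, 2 <= j <= n -> d' j < a j) ->
  \sum_(2 <= j < n.+1) d j * weight j = \sum_(2 <= j < n.+1) d' j * weight j ->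
  forall j, 2 <= j <= n -> d j = d' j.
Proof.
elim: n => // n IHn hn hd hd'; case: (ltngtP n 0) => // [n0|n0]; last by lia.
rewrite big_nat_recr //= [X in _ = X -> _]big_nat_recr //=.
have s1 : \sum_(2 <= j < n.+1) d j * weight j < weight n.+1.
  by apply: digit_sum_lt => [|j hj]; [lia | apply: hd; lia].
have s2 : \sum_(2 <= j < n.+1) d' j * weight j < weight n.+1.
  by apply: digit_sum_lt => [|j hj]; [lia | apply: hd'; lia].
move=> eq_s.
have eq_d : d n.+1 = d' n.+1.
  have w0 : 0 < weight n.+1 by apply: leq_ltn_trans s1.
  have := congr1 (divn ^~ (weight n.+1)) eq_s.
  by rewrite /= 2![_ + _ * _]addnC !divnMDl // !divn_small // !addn0.
have {}eq_s : \sum_(2 <= j < n.+1) d j * weight j =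
    \sum_(2 <= j < n.+1) d' j * weight j.
  by move: eq_s; rewrite eq_d => /addIn.
move=> j hj; case: (ltngtP j n.+1) => [h||->] //; last by lia.
by apply: IHn => // [|i hi|i hi|]; [lia|apply: hd; lia|apply: hd'; lia|lia].
Qed.

Lemma flat_bounds x : 1 <= flat x <= P_ k a 1.
Proof.
rewrite flatE /=; apply: digit_sum_lt => [|j hj]; first by lia.
by have := @coord_bounds x j; lia.
Qed.

Lemma flat_inj x y : coord x 1 = coord y 1 -> flat x = flat y -> x = y.
Proof.
move=> eq1; rewrite !flatE => /succn_inj eq_s; apply: coord_inj => j hj.
case: (ltngtP 1 j) => [h||<-] //; last by lia.
have := @digit_sum_inj (fun j => (coord x j).-1) (fun j => (coord y j).-1) k.
have cx := @coord_bounds x; have cy := @coord_bounds y.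
move/(_ _ _ _ eq_s j); have := cx j hj; have := cy j hj => h1 h2 H.
suff : (coord x j).-1 = (coord y j).-1 by lia.
by apply: H; [lia|move=> i hi; have := cx i; lia|move=> i hi; have := cy i; lia|lia].
Qed.

Lemma card_grid : #|grid| = volume k.
Proof.
rewrite card_dep_ffun foldrE big_map big_enum /= /volume big_add1 big_mkord.
by apply: eq_bigr => i _; rewrite card_ord.
Qed.

(** By counting: (x_1, flat x) is injective into a set with as many elements as the grid. *)
Lemma flat_surj i m : 1 <= i <= a 1 -> 1 <= m <= P_ k a 1 ->
  exists2 x : grid, coord x 1 = i & flat x = m.
Proof.
move=> hi hm.
have b1 (x : grid) : (coord x 1).-1 < a 1 by have := @coord_bounds x 1; lia.
have b2 (x : grid) : (flat x).-1 < P_ k a 1 by have := flat_bounds x; lia.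
pose f (x : grid) := (Ordinal (b1 x), Ordinal (b2 x)).
have f_inj : injective f.
  move=> x y /eqP; rewrite xpair_eqE -!val_eqE /= => /andP[/eqP e1 /eqP e2].
  apply: flat_inj; last by have := flat_bounds x; have := flat_bounds y; lia.
  by have := @coord_bounds x 1; have := @coord_bounds y 1; lia.
have [|g fK gK] := inj_card_bij f_inj.
  rewrite card_prod !card_ord card_grid -(@volume_P 1); last by lia.
  by rewrite /volume big_nat1.
have i1 : i.-1 < a 1 by lia.
have m1 : m.-1 < P_ k a 1 by lia.
exists (g (Ordinal i1, Ordinal m1)); have /eqP := gK (Ordinal i1, Ordinal m1);
  rewrite xpair_eqE -!val_eqE /= => /andP[/eqP e1 /eqP e2].
- by have := @coord_bounds (g (Ordinal i1, Ordinal m1)) 1; lia.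
- by have := flat_bounds (g (Ordinal i1, Ordinal m1)); lia.
Qed.

(** Grid edges are oriented towards the larger coordinate, so that the expected change of the last
    entry has a definite sign. *)
Definition step R x y := [/\ 1 <= R <= k, coord y R = (coord x R).+1
  & forall j, 1 <= j <= k -> j != R -> coord y j = coord x j].

Lemma grid_adj_step x y : grid_adj x y ->
  exists R, step R x y \/ step R y x.
Proof.
rewrite /grid_adj => /eqP sum1.
have [i ni] : exists i : 'I_k, x i != y i :> nat.
  apply/existsP; apply: contraT => /existsPn eq_xy.
  by move: sum1; rewrite big1 // => i _; have := eq_xy i; lia.
move: sum1; rewrite (bigD1 i) //= => sum1.
have e0 j : j != i -> x j = y j :> nat.
  move=> hj; move: sum1; rewrite (bigD1 j) //=.
  by move: ni; move: (x i : nat) (y i : nat) (x j : nat) (y j : nat) => /= *; lia.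
have d1 : (y i = (x i).+1 :> nat) \/ (x i = (y i).+1 :> nat).
  by move: ni sum1; move: (x i : nat) (y i : nat) => /= *; lia.
exists i.+1; case: d1 => d1; [left | right]; split.
- exact: (ltn_ord i).
- by rewrite !coordE d1.
- case=> // j /= hj nj; rewrite (coordE x (Ordinal hj)) (coordE y (Ordinal hj)) e0 //.
- exact: (ltn_ord i).
- by rewrite !coordE d1.
- case=> // j /= hj nj; rewrite (coordE x (Ordinal hj)) (coordE y (Ordinal hj)) e0 //.
Qed.

Lemma step_inj R x x' y : step R x y -> step R x' y -> x = x'.
Proof.
move=> [hR h1 h2] [_ g1 g2]; apply: coord_inj => j hj.
case: (eqVneq j R) => [->|nj]; first by lia.
by rewrite -h2 // -g2.
Qed.

Lemma step_flat R x y : step R x y ->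
  flat y = flat x + (if R == 1 then 0 else weight R).
Proof.
move=> [hR h1 h2]; rewrite !flatE addSn; congr _.+1.
case: eqVneq => R1.
  rewrite addn0; apply: eq_big_nat => j hj; rewrite h2 //; first by lia.
  by rewrite R1; lia.
rewrite [LHS](bigD1_seq R) ?[X in _ = X + _](bigD1_seq R) ?iota_uniq
  ?mem_index_iota //=; try lia.
rewrite h1 /=; have cx := coord_bounds x hR.
have -> : \sum_(2 <= i < k.+1 | i != R) (coord y i).-1 * weight i =
          \sum_(2 <= i < k.+1 | i != R) (coord x i).-1 * weight i.
  rewrite big_nat_cond [RHS]big_nat_cond; apply: eq_bigr => j /andP[hj nj].
  by rewrite h2 //; lia.
rewrite addnAC -mulSnr prednK //; lia.
Qed.

End Grid.

(** * The maps f_i *)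

Section Maps.
Variables (k : nat) (a : nat -> nat) (F : nat -> nat -> nat -> bool).
Hypothesis k2 : 2 <= k.
Hypothesis a_large : forall i, 1 <= i <= k -> 2 ^ 22 <= a i.
Hypothesis F_round : forall i, 2 <= i < k -> blank_rounding k a i (F i).
Local Notation grid := (grid k a).
Local Notation coord := Defs.coord.
Implicit Types x y : grid.

Definition dig i := digit (side a i) (P_ k a i) (F i).
Definition lev i := level (side a i) (P_ k a i) (F i).

(** [top m] is the last entry of f_(m+2) and [lab l] its l-th entry for l at most m + 1. Unlike
    [stack], this recursion treats each grid point separately; [f_from2E] proves the agreement. *)
Fixpoint top m x := if m is m'.+1 then lev m'.+2 (top m' x)
                    else (chain a (coord x 1) (flat x)).2.

Definition lab l x := if l <= 1 then (chain a (coord x 1) (flat x)).1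
                      else dig l (top (l - 2) x).

Lemma a1_bounds :
  [/\ 0 < a 1, a 1 <= 2 ^ e_ a 1 & 2 ^ e_ a 1 < 2 * a 1].
Proof.
have a0 : 0 < a 1 by apply: (length_gt0 a_large); lia.
have := @volume_e k a k2 a_large 1; rewrite /volume big_nat1.
by move/(_ (ltnW k2))/andP => [].
Qed.

Lemma chain_col_x x : [/\ 1 <= top 0 x,
   2 ^ e_ a 1 * (top 0 x).-1 < flat x * a 1
  & flat x * a 1 < 2 ^ e_ a 1 * top 0 x + a 1].
Proof.
have [a0 a1 a2] := a1_bounds; apply: chain_col_bounds => //.
  by apply: coord_bounds; lia.
by case/andP: (flat_bounds k2 x).
Qed.

Lemma chain_row_x x : [/\ 1 <= lab 1 x <= 2 ^ e_ a 1,
   2 ^ e_ a 1 * (coord x 1).-1 < lab 1 x * a 1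
  & lab 1 x * a 1 < 2 ^ e_ a 1 * coord x 1 + a 1].
Proof.
have [a0 a1 a2] := a1_bounds; apply: chain_row_bounds => //.
  by apply: coord_bounds; lia.
by case/andP: (flat_bounds k2 x).
Qed.

Local Notation hP i := (ceil_level a i (P_ k a i)).

Section OneLevel.
Variable i : nat.
Hypothesis hi : 2 <= i < k.

Let q0 : 0 < side a i. Proof. exact: side_gt0. Qed.

Let rows c b : 1 <= c <= P_ k a i -> 1 <= b <= side a i ->
  b * (ceil_level a i c - ceil_level a i c.-1)
     < side a i * row_count (F i) c b + side a i /\
  side a i * row_count (F i) c b
     < b * (ceil_level a i c - ceil_level a i c.-1) + side a i.
Proof. exact: row_count_bounds (F_round hi) _ _. Qed.

Let cols d b : 1 <= d <= side a i -> 1 <= b <= P_ k a i ->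
  ceil_level a i b < side a i * col_count (F i) b d + side a i /\
  side a i * col_count (F i) b d < ceil_level a i b + side a i.
Proof. exact: col_count_bounds (F_round hi) _ _. Qed.

Let h0 := ceil_level0 a i.
Let hm := ceil_level_mono a i.

Let e_i : 2 ^ e_ a i.-1 * side a i = 2 ^ e_ a i.
Proof. by apply: (@e_side k a k2 a_large); lia. Qed.

Let vol : volume a i <= 2 ^ e_ a i.-1 * side a i < 2 * volume a i.
Proof. by rewrite e_i; apply: (@volume_e k a k2 a_large); lia. Qed.

Lemma dig_bounds z : 1 <= dig i z <= side a i.
Proof. exact: digit_bounds. Qed.

Lemma dig_lev_inj z1 z2 : 1 <= z1 <= hP i -> 1 <= z2 <= hP i ->
  dig i z1 = dig i z2 -> lev i z1 = lev i z2 -> z1 = z2.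
Proof. exact: digit_level_inj h0 hm rows _ _. Qed.

Lemma lev_gt0 z : 1 <= z <= hP i -> 1 <= lev i z.
Proof. exact: level_gt0 h0 hm rows _. Qed.

Lemma lev_fibre z w : 1 <= z <= hP i -> 1 <= w <= lev i z ->
  exists z', [/\ 1 <= z' <= z, dig i z' = dig i z & lev i z' = w].
Proof. exact: level_fibre h0 hm rows _ _. Qed.

Lemma lev_ceil z : 1 <= z <= hP i -> 2 ^ e_ a i * (lev i z).-1 < volume a k.
Proof.
move=> hz.
have l := level_ceil q0 h0 hm rows cols hz; rewrite -/(lev i z) in l.
rewrite -e_i -mulnA.
have /andP[_ h] := ceil_level_bounds a i (P_ k a i).
rewrite -/(volume a i) (mulnC (P_ k a i)) (@volume_P k) ?(ltnW (proj2 (andP hi))) // in h.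
move: l h; set E := 2 ^ _ => l h.
have : E * (side a i * (lev i z).-1).+1 <= E * hP i by rewrite leq_mul2l l orbT.
rewrite mulnS; lia.
Qed.

Lemma lev_close z1 z2 m : 1 <= z1 <= hP i -> 1 <= z2 <= hP i ->
  (`|(2 ^ e_ a i.-1)%N%:Z * (z2%:Z - z1%:Z) - (m * volume a i)%N%:Z|
     <= 5 * (2 ^ e_ a i.-1)%N%:Z)%R ->
  (exists s : int, `|(dig i z2)%:Z - (dig i z1)%:Z + s * (side a i)%:Z| <= 15)%R /\
  (`|(2 ^ e_ a i)%N%:Z * ((lev i z2)%:Z - (lev i z1)%:Z) - (m * volume a i)%N%:Z|
     <= 4 * (2 ^ e_ a i)%N%:Z)%R.
Proof.
rewrite PoszM -e_i => hz1 hz2; have /andP[v1 v2] := vol.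
apply: (@level_close _ _ _ q0 (ceil_level a i)) => //.
- by rewrite expn_gt0.
- exact: ceil_level_bounds.
- by have := @side_ge k a k2 a_large i; lia.
Qed.

End OneLevel.

Lemma labE m x : lab m.+2 x = dig m.+2 (top m x).
Proof. by rewrite /lab /= !subSS subn0. Qed.

Lemma chain_eq x y : lab 1 x = lab 1 y -> top 0 x = top 0 y ->
  chain a (coord x 1) (flat x) = chain a (coord y 1) (flat y).
Proof.
rewrite /lab /=; case: (chain a (coord x 1) _) => u v.
by case: (chain a (coord y 1) _) => u' v' /= -> ->.
Qed.

Lemma hP_ge z i : i <= k -> 2 ^ e_ a i.-1 * z.-1 < volume a k -> z <= hP i.
Proof.
move=> hi lt_z; have /andP[h _] := ceil_level_bounds a i (P_ k a i).
rewrite -/(volume a i) (mulnC (P_ k a i)) (volume_P a hi) in h.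
have := leq_trans lt_z h; rewrite ltn_pmul2l ?expn_gt0 //; lia.
Qed.

Lemma volume1 : volume a 1 = a 1.
Proof. by rewrite /volume big_nat1. Qed.

Lemma top_bounds m x : m.+2 <= k ->
  1 <= top m x <= hP m.+2 /\ 2 ^ e_ a m.+1 * (top m x).-1 < volume a k.
Proof.
move=> hm; suff [h1 h2] : 1 <= top m x /\
    2 ^ e_ a m.+1 * (top m x).-1 < volume a k.
  by rewrite h1 h2 (@hP_ge _ m.+2).
elim: m hm => [|m IHm] hm.
  have [h1 h2 _] := chain_col_x x; split=> //; apply: leq_trans h2 _.
  rewrite -(@volume_P k a 1) ?volume1 1?mulnC ?leq_mul2l; last by lia.
  by have /andP[_ ->] := flat_bounds k2 x; rewrite orbT.
have [h1 h2] := IHm (ltnW hm).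
have hz : 1 <= top m x <= hP m.+2 by rewrite h1 (@hP_ge _ m.+2) //; lia.
by split; [apply: lev_gt0 | apply: lev_ceil].
Qed.

Lemma top_hP m x : m.+2 <= k -> 1 <= top m x <= hP m.+2.
Proof. by move/top_bounds => /(_ x) []. Qed.

(** Residue and height recover the previous last entry by [dig_lev_inj]; descending in this way ends
    at the injectivity of the chains. *)
Lemma top_inj m x y : m.+2 <= k ->
  (forall l, 1 <= l <= m.+1 -> lab l x = lab l y) ->
  top m x = top m y -> x = y.
Proof.
elim: m => [|m IHm] hm eq_l eq_t.
  have [a0 a1 a2] := a1_bounds.
  have cx := @coord_bounds k a k2 x 1 (ltnW k2).
  have cy := @coord_bounds k a k2 y 1 (ltnW k2).
  have /andP[fx _] := flat_bounds k2 x; have /andP[fy _] := flat_bounds k2 y.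
  have [] := chain_inj a0 a1 a2 cx cy fx fy (chain_eq (eq_l 1 isT) eq_t).
  exact: flat_inj.
apply: IHm => [|l hl|]; [by lia|by apply: eq_l; lia|].
apply: (@dig_lev_inj m.+2) eq_t; rewrite ?top_hP //; try lia.
by rewrite -!labE eq_l //; lia.
Qed.

(** Induction from [chain_surj] through [lev_fibre]: all smaller last entries occur over the same
    earlier labels. *)
Lemma top_fibre m x w : m.+2 <= k -> 1 <= w <= top m x ->
  exists2 y, top m y = w & forall l, 1 <= l <= m.+1 -> lab l y = lab l x.
Proof.
elim: m x w => [|m IHm] x w hm hw.
  (* The case w = [top 0 x] is separate because the bound on j below needs w to be at most
     [(top 0 x).-1]; otherwise the point found might lie outside the grid. *)
  case: (eqVneq w (top 0 x)) => [->|nw]; first by exists x.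
  have [a0 a1 a2] := a1_bounds; have [r1 _ _] := chain_row_x x.
  have w0 : 0 < w by case/andP: hw.
  have [i [j [hi hj ch]]] := chain_surj a0 a1 a2 r1 w0.
  have le_j : 1 <= j <= P_ k a 1.
    rewrite (proj1 (andP hj)) /=; apply: leq_trans (proj2 (andP hj)) _.
    have [l _] := N_bound a0 a1 a2 w hi; have [_ t _] := chain_col_x x.
    have t2 : 2 ^ e_ a 1 * w <= 2 ^ e_ a 1 * (top 0 x).-1.
      by rewrite leq_mul2l; apply/orP; right; lia.
    have t3 : flat x * a 1 <= P_ k a 1 * a 1.
      by have /andP[_ h] := flat_bounds k2 x; rewrite leq_mul2r h orbT.
    by rewrite -ltnS -(ltn_pmul2r a0) mulSn; lia.
  have [y y1 y2] := flat_surj k2 hi le_j.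
  exists y; rewrite /= ?y1 ?y2 ?ch // => l hl.
  have -> : l = 1 by lia.
  by rewrite {1}/lab /= y1 y2 ch.
have hz := @top_hP m x (ltnW hm).
have [||z [hz1 hz2 hz3]] := @lev_fibre m.+2 _ (top m x) w hz; [by lia|by []|].
have [y ty ly] := IHm x z (ltnW hm) hz1.
exists y; first by rewrite /= ty.
move=> l hl; case: (ltngtP l m.+2) => [h||->]; last by rewrite !labE ty.
  by apply: ly; lia.
by lia.
Qed.

Definition pre m x := [seq lab l x | l <- iota 1 m.+1].

Lemma eq_pre m x y :
  pre m x = pre m y <-> forall l, 1 <= l <= m.+1 -> lab l x = lab l y.
Proof.
split=> [/eq_in_map h l hl|h]; first by apply: h; rewrite mem_iota; lia.
by apply/eq_in_map => l; rewrite mem_iota => hl; apply: h; lia.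
Qed.

Lemma size_pre m x : size (pre m x) = m.+1.
Proof. by rewrite size_map size_iota. Qed.

Lemma take_pre m x w : take m.+1 (rcons (pre m x) w) = pre m x.
Proof. by rewrite -cats1 take_cat size_pre ltnn subnn cats0. Qed.

Lemma nth_pre m x w : nth 0 (rcons (pre m x) w) m.+1 = w.
Proof. by rewrite nth_rcons size_pre ltnn eqxx. Qed.

Lemma inflate_top m x : inflate k a F m.+2 (rcons (pre m x) (top m x)) =
  rcons (pre m x) (pos (side a m.+2) (P_ k a m.+2) (F m.+2) (top m x)).
Proof.
by rewrite /inflate [m.+2.-1]/= take_pre nth_pre.
Qed.

Lemma size_col_count (G : nat -> nat -> bool) r d :
  size [seq c <- iota 1 r | ~~ G c d] = col_count G r d.
Proof.
elim: r => [|r IHr]; first by rewrite /col_count big_geq.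
by rewrite iota1S filter_cat size_cat IHr col_count_S /=; case: (G _ _).
Qed.

(* Every fibre of f_i over its first i - 1 entries is an initial segment
   (top_fibre), so that the stacking count is a column count of the matrix F i. *)
Lemma stack_top m x : m.+2 < k ->
  stack a m.+2 [seq rcons (pre m z)
      (pos (side a m.+2) (P_ k a m.+2) (F m.+2) (top m z)) | z : grid]
    (rcons (pre m x) (pos (side a m.+2) (P_ k a m.+2) (F m.+2) (top m x))) =
  rcons (pre m.+1 x) (top m.+1 x).
Proof.
move=> hm; set ps := pos _ _ _; set S := [seq _ | z : grid].
have tk := take_pre m; have nt := nth_pre m.
rewrite /stack [m.+2.-1]/= tk nt.
have -> : rcons (pre m.+1 x) (top m.+1 x) = pre m x ++ [:: dig m.+2 (top m x); top m.+1 x].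
  rewrite /pre (iota1S m.+1) map_cat /= labE -cats1 -catA //.
congr (_ ++ [:: _; _]).
set q := 2 ^ p_ a m.+2; set p := fun z => _.
have q0 : 0 < q by rewrite expn_gt0.
have rw := @row_count_bounds k a m.+2 (F m.+2) (F_round (_ : 2 <= m.+2 < k)).
have {}rw := rw hm.
have pP z : 1 <= ps (top m z) <= P_ k a m.+2 * q
      /\ nonblank q (F m.+2) (ps (top m z)).
  have [|h1 h2 _] := posP q0 (ceil_level0 a m.+2) (ceil_level_mono a m.+2) rw
    (z := top m z); first exact: top_hP (ltnW hm).
  by split.
pose r := rowof q (ps (top m x)).
(* [L] lists the points counted by n_y: one for each nonblank entry of the column in rows up to
   r. *)
pose L := [seq rcons (pre m x) (c.-1 * q + dig m.+2 (top m x))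
   | c <- [seq c <- iota 1 r | ~~ F m.+2 c (dig m.+2 (top m x))]].
have dq : 1 <= dig m.+2 (top m x) <= q by apply: dig_bounds.
suff -> : count p (undup S) = size L by rewrite size_map size_col_count.
rewrite -size_filter; apply/perm_size/uniq_perm.
- by rewrite filter_uniq ?undup_uniq.
- rewrite map_inj_in_uniq ?filter_uniq ?iota_uniq // => c c'.
  rewrite !mem_filter !mem_iota => /andP[_ hc] /andP[_ hc'].
  move/rcons_inj => [] /addIn /eqP; rewrite eqn_mul2r; lia.
move=> y; rewrite mem_filter mem_undup; apply/andP/mapP.
  move=> [py /imageP[x' _ ey]]; move: py; rewrite {}ey /p tk nt.
  have [b1 nb1] := pP x'; have [b2 nb2] := pP x.
  case/and3P=> /eqP epre; rewrite -/q mod_resid ?leq_rowof //; try lia.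
  move=> /eqP er le_r; exists (rowof q (ps (top m x'))).
    rewrite mem_filter mem_iota; apply/andP; split; last by rewrite add1n ltnS le_r.
    by move: nb1; rewrite /nonblank er.
  by rewrite epre; congr rcons; rewrite [LHS](@row_resid q) ?er //; lia.
case=> c; rewrite mem_filter mem_iota => /andP[nb hc] ->.
have hcr : 1 <= c <= rowof q (ps (top m x)) by rewrite -/r; lia.
(* Every listed entry is attained: [pos_below] gives a smaller last entry, and [top_fibre] a grid
   point having it with the same prefix. *)
have [z hz ez] := pos_below q0 (ceil_level0 a m.+2) (ceil_level_mono a m.+2) rw
   (top_hP x (ltnW hm)) hcr nb.
have {}ez : ps z = c.-1 * q + dig m.+2 (top m x) := ez.
have [x' tx' lx'] := top_fibre (ltnW hm) hz.
have epre : pre m x' = pre m x by apply/eq_pre.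
have es : rcons (pre m x) (c.-1 * q + dig m.+2 (top m x)) =
          rcons (pre m x') (ps (top m x')).
  by rewrite epre tx' ez.
split; last by rewrite es; apply: image_f.
have [b1 nb1] := pP x'; have [b2 nb2] := pP x.
rewrite es /p tk nt epre eqxx /= -/q mod_resid ?leq_rowof //; try lia.
rewrite tx' ez residE // (rowofE q0) //; last by lia.
by rewrite eqxx; case/andP: hcr.
Qed.

Lemma f_from2E m x : m.+2 <= k ->
  f_from2 F m x = rcons (pre m x) (top m x).
Proof.
elim: m x => [|m IHm] x hm; first by rewrite /= /f2 /pre /= /lab.
rewrite -stack_top // /= /next_f IHm ?(ltnW hm) // inflate_top.
congr stack; apply: eq_map => z; by rewrite IHm ?(ltnW hm) // inflate_top.
Qed.

End Maps.

(** * Labels along grid edges *)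

Section Labels.
Variables (k : nat) (a : nat -> nat) (F : nat -> nat -> nat -> bool).
Hypothesis k2 : 2 <= k.
Hypothesis a_large : forall i, 1 <= i <= k -> 2 ^ 22 <= a i.
Hypothesis F_round : forall i, 2 <= i < k -> blank_rounding k a i (F i).
Local Notation grid := (grid k a).
Local Notation coord := Defs.coord.
Implicit Types x y : grid.

Local Notation top := (top F).
Local Notation lab := (lab F).
Local Notation hP i := (ceil_level a i (P_ k a i)).

(** The last block carries the final height itself, as no further residue is taken at stage k. *)
Definition Lab j x := if j == k then top (k - 2) x else lab j x.

Lemma f_kE j x : 1 <= j <= k -> nth 0 (f_ F k x) j.-1 = Lab j x.
Proof.
move=> hj; rewrite /f_ /Lab; have ek : k = (k - 2).+2 by lia.
rewrite f_from2E -?ek // nth_rcons size_pre.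
case: (eqVneq j k) => [->|nj].
  have -> : k.-1 = (k - 2).+1 by lia.
  by rewrite ltnn eqxx.
have lt_j : j.-1 < (k - 2).+1 by lia.
rewrite lt_j (nth_map 0) ?size_iota // nth_iota // add1n prednK //; lia.
Qed.

Lemma Lab_bounds j x : 1 <= j <= k -> 1 <= Lab j x <= side a j.
Proof.
move=> hj; rewrite /Lab; have ek : k = (k - 2).+2 by lia.
case: eqVneq => [->|nj].
  have := @top_bounds k a F k2 a_large F_round (k - 2) x.
  rewrite -ek => /(_ (leqnn _)) [/andP[-> _] h2] /=.
  have ek1 : (k - 2).+1 = k.-1 by lia.
  have hk : 1 <= k <= k by lia.
  have /andP[v1 _] := volume_e k2 a_large (leqnn k).
  have := leq_trans h2 v1; rewrite -(e_side k2 a_large hk) ek1.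
  by rewrite ltn_pmul2l ?expn_gt0 //; lia.
case: j hj nj => [|[|j]] // hj nj; last by rewrite labE; apply: dig_bounds.
have [h _ _] := chain_row_x F k2 a_large x.
move: h; rewrite -(e_side k2 a_large hj) /=.
have -> : e_ a 0 = 0 by rewrite /e_ big_geq.
by rewrite mul1n.
Qed.

(** Downward recursion from stage k: the label of a block and the height above it determine the last
    entry at that stage. *)
Lemma top_det m x y : m.+2 <= k ->
  (forall l, m.+2 <= l <= k -> Lab l x = Lab l y) -> top m x = top m y.
Proof.
move=> hm; have [n en] : exists n, n = k - m.+2 by exists (k - m.+2).
elim: n m en hm => [|n IHn] m en hm eq_l.
  have := eq_l m.+2; rewrite /Lab; have -> : m.+2 = k by lia.
  rewrite eqxx; have -> : k - 2 = m by lia.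
  by apply; lia.
have nk : m.+2 == k = false by apply/eqP; lia.
apply: (@dig_lev_inj k a F F_round m.+2); rewrite ?top_hP //; try lia.
  by have := eq_l m.+2; rewrite /Lab nk !labE; apply; lia.
by apply: (IHn m.+1) => [||l hl]; [lia|lia|apply: eq_l; lia].
Qed.

Lemma Lab_inj_prefix m x y : m.+2 <= k ->
  (forall l, 1 <= l <= m.+1 -> Lab l x = Lab l y) ->
  top m x = top m y -> x = y.
Proof.
move=> hm eq_l; apply: top_inj => // l hl.
have := eq_l l hl; rewrite /Lab; case: eqVneq => // elk; lia.
Qed.

Lemma Lab_inj x y : (forall l, 1 <= l <= k -> Lab l x = Lab l y) -> x = y.
Proof.
move=> eq_l; apply: (@Lab_inj_prefix 0) => // [l hl|]; first by apply: eq_l; lia.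
by apply: top_det => // l hl; apply: eq_l; lia.
Qed.

(* Up to the factor 2 ^ e_ a i.-1, the amount by which the last entry of f_i
   should change along a grid edge of direction R. *)
Definition shift R i := if R <= i then 0 else volume a R.-1.

Definition shift_mult R i := if R <= i then 0 else \prod_(i.+1 <= l < R) a l.

(** Writes the shift as an integer multiple of the volume, the form needed by [lev_close]. *)
Lemma shiftE R i : shift R i = shift_mult R i * volume a i.
Proof.
rewrite /shift /shift_mult; case: leqP => // lt_iR.
rewrite mulnC /volume -big_cat_nat //; by case: R lt_iR.
Qed.

(** The error is 4 from [lev_close], plus 1 at the single stage R where the expected shift drops
    from a_1 ... a_(R-1), at most 2^(e_(R-1)), to 0. *)
Lemma step_top m R x y : m.+2 <= k -> step R x y ->
  (`|(2 ^ e_ a m.+1)%N%:Z * ((top m y)%:Z - (top m x)%:Z) - (shift R m.+2)%:Z|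
     <= 5 * (2 ^ e_ a m.+1)%N%:Z)%R.
Proof.
move=> hm xy; elim: m hm => [|m IHm] hm.
  have [a0 a1 a2] := a1_bounds k2 a_large.
  have [_ x1 x2] := chain_col_x F k2 a_large x.
  have [_ y1 y2] := chain_col_x F k2 a_large y.
  have ef := step_flat k2 xy; have [hR _ _] := xy.
  have es : (if R == 1 then 0 else weight a R) * a 1 =
            if R == 1 then 0 else volume a R.-1.
    case: eqVneq => // nR; rewrite mulnC /volume /weight prednK; last by lia.
    by rewrite [in RHS]big_ltn //; lia.
  (* For R = 2 the product [flat x * a 1] grows by a_1 although the shift at stage 2 is already 0;
     this a_1 is at most 2^(e_1) and is charged to the error. *)
  have wa : (if R == 2 then a 1 else shift R 2) =
            (if R == 1 then 0 else volume a R.-1).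
    rewrite /shift; case: R hR {xy ef es} => [|[|[|R]]] //.
    by rewrite volume1.
  have {}ef : flat y * a 1 = flat x * a 1 + if R == 2 then a 1 else shift R 2.
    by rewrite ef mulnDl es wa.
  have s2 : R == 2 -> shift R 2 = 0 by move/eqP->.
  have tx0 : 0 < top 0 x by have [] := chain_col_x F k2 a_large x.
  have ty0 : 0 < top 0 y by have [] := chain_col_x F k2 a_large y.
  case: (top 0 x) (top 0 y) tx0 ty0 x1 x2 y1 y2 => [|u] [|v] //= _ _ x1 x2 y1 y2.
  move: (2 ^ e_ a 1) x1 x2 y1 y2 a1 a2 => b *.
  by case: eqVneq ef s2 => // R2 ef s2; [have {}s2 := s2 isT |]; lia.
have {IHm} hx := IHm (ltnW hm); rewrite shiftE in hx.
have tx := top_hP k2 a_large F_round x (ltnW hm).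
have ty := top_hP k2 a_large F_round y (ltnW hm).
have [|_] := @lev_close k a F k2 a_large F_round m.+2 _ _ _ _ tx ty hx.
  by lia.
rewrite -shiftE -[top m.+1 x]/(lev k a F m.+2 (top m x)).
rewrite -[top m.+1 y]/(lev k a F m.+2 (top m y)).
move: (lev _ _ _ _ (top m x)) (lev _ _ _ _ (top m y)) => u v.
have e22 := e_mono k2 a_large hm.
case: (ltngtP R m.+3) => hR.
- have -> : shift R m.+3 = 0 by rewrite /shift ltnW.
  have -> : shift R m.+2 = 0 by rewrite /shift -ltnS hR.
  by lia.
- have -> : shift R m.+3 = volume a R.-1 by rewrite /shift leqNgt hR.
  have -> : shift R m.+2 = volume a R.-1 by rewrite /shift leqNgt ltnW.
  by lia.
have -> : shift R m.+3 = 0 by rewrite /shift hR leqnn.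
have -> : shift R m.+2 = volume a m.+2 by rewrite /shift hR ltnn.
have /andP[+ _] := @volume_e k a k2 a_large m.+2 (ltnW hm).
by lia.
Qed.

Lemma step_Lab R x y j : step R x y -> 1 <= j <= k ->
  exists s : int, (`|(Lab j y)%:Z - (Lab j x)%:Z + s * (side a j)%:Z| <= 15)%R.
Proof.
move=> xy hj; have ek : k = (k - 2).+2 by lia.
rewrite /Lab; case: eqVneq => [jk|nj].
  (* At stage k the shift vanishes for every direction, so the last entries differ by at most 5 with
     no wrap-around. *)
  exists 0%R; have := @step_top (k - 2) R x y; rewrite -ek => /(_ (leqnn _) xy).
  have -> : shift R k = 0 by rewrite /shift; case: xy => /andP[_ ->].
  have E0 : (0 < (2 ^ e_ a (k - 2).+1)%N%:Z)%R by rewrite ltz_nat expn_gt0.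
  rewrite subr0 normrM (gtr0_norm E0) mulrC ler_pM2r // mul0r addr0; lia.
case: j hj nj => [|[|m]] // hj nj; last first.
  have hm : m.+2 <= k by lia.
  have hx := step_top hm xy; rewrite shiftE in hx.
  have tx := top_hP k2 a_large F_round x hm.
  have ty := top_hP k2 a_large F_round y hm.
  have [|h _] := @lev_close k a F k2 a_large F_round m.+2 _ _ _ _ tx ty hx.
    by lia.
  by rewrite !labE.
(* In the first block a change of at most 1 in x_1 moves the row by less than 5, again without
   wrap-around. *)
exists 0%R; rewrite mul0r addr0.
have [a0 a1 a2] := a1_bounds k2 a_large.
have [_ x1 x2] := chain_row_x F k2 a_large x.
have [_ y1 y2] := chain_row_x F k2 a_large y.
have [hR h1 h2] := xy.
have cx := @coord_bounds k a k2 x 1 (ltnW k2).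
have cy : Defs.coord y 1 = Defs.coord x 1 \/ Defs.coord y 1 = (Defs.coord x 1).+1.
  case: (eqVneq R 1) => [R1|nR]; [right; by rewrite -R1 | left; apply: h2; lia].
move: (Defs.coord x 1) (Defs.coord y 1) x1 x2 y1 y2 cx cy => [|c] d //= x1 x2 y1 y2 cx cy.
move: (lab 1 x) (lab 1 y) x1 x2 y1 y2 => u v x1 x2 y1 y2.
have A0 : (0 < (a 1)%:Z)%R by lia.
have h3 : ((a 1)%:Z * (v%:Z - u%:Z) < (a 1)%:Z * 16)%R by case: cy => ed; rewrite ed in y1 y2; lia.
have h4 : ((a 1)%:Z * - 16 < (a 1)%:Z * (v%:Z - u%:Z))%R.
  by case: cy => ed; rewrite ed in y1 y2; lia.
by move: h3 h4; rewrite !ltr_pM2l //; lia.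
Qed.

End Labels.

(** * Walks in hypercubes *)

Section Walks.
Variables (T : finType) (e : rel T).

Definition walk_le n u v :=
  exists q : seq T, [/\ path e u q, last u q = v & size q <= n].

Lemma walk_le0 u : walk_le 0 u u.
Proof. by exists [::]. Qed.

Lemma walk_le_trans m n u v w :
  walk_le m u v -> walk_le n v w -> walk_le (m + n) u w.
Proof.
move=> [q [q1 q2 q3]] [q' [q1' q2' q3']]; exists (q ++ q').
by rewrite cat_path q1 q2 last_cat q2 size_cat leq_add.
Qed.

Lemma gdist_le n u v : walk_le n u v -> gdist e u v <= n.
Proof.
move=> [q [pq lq sq]]; rewrite /gdist; apply: leq_trans _ sq.
set P := fun m : nat => _; have Pq : P (size q).
  by apply/existsP; exists (in_tuple q); rewrite /= pq lq eqxx.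
case: (ltnP (size q) #|T|) => [lt_q|]; last first.
  (* A walk of length at least [#|T|] gives the bound trivially, since [find] never exceeds the
     length of the list searched. *)
  by apply: leq_trans; rewrite -[leqRHS](size_iota 0) find_size.
rewrite leqNgt; apply/negP => /(before_find 0).
by rewrite nth_iota // Pq.
Qed.

Lemma path_edgesP (f : rel T) z q B : path f z q -> B \in path_edges (z :: q) ->
  exists u v, f u v /\ B = [set u; v].
Proof.
elim: q z => [|w q IHq] z //= /andP[fzw pq].
rewrite /path_edges /= inE => /orP[/eqP->|]; first by exists z, w.
exact: IHq pq.
Qed.

Lemma walk_simple n u v : walk_le n u v ->
  exists q, [/\ path e u q, last u q = v & uniq (u :: q)].
Proof.
move=> [q [pq lq _]]; move: lq; case: (shortenP pq) => q' pq' uq' _ lq'.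
by exists q'.
Qed.

End Walks.

Lemma walk_le_sub (T : finType) (e e' : rel T) n u v :
  subrel e e' -> walk_le e n u v -> walk_le e' n u v.
Proof. by move=> s [q [pq lq sq]]; exists q; rewrite (sub_path s). Qed.

(** * Cube vertices as concatenations of block labels *)

Section CubeSeq.

Definition hamming (s t : seq bool) := count (fun p => p.1 != p.2) (zip s t).

Lemma hamming_cat s1 s2 t1 t2 : size s1 = size t1 ->
  hamming (s1 ++ s2) (t1 ++ t2) = hamming s1 t1 + hamming s2 t2.
Proof. by move=> h; rewrite /hamming zip_cat // count_cat. Qed.

Lemma hamming_refl s : hamming s s = 0.
Proof. by rewrite /hamming; elim: s => //= b s ->; rewrite eqxx. Qed.

Lemma cube_adjE n (u v : cube n) : cube_adj u v = (hamming u v == 1).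
Proof.
rewrite /cube_adj /hamming; congr (_ == 1).
rewrite -(map_tnth_enum u) -(map_tnth_enum v) zip_map count_map.
rewrite enumT cardE /enum_mem size_filter.
by apply: eq_count => i; rewrite /= inE.
Qed.

Lemma cube_adj_sym n (u v : cube n) : cube_adj u v = cube_adj v u.
Proof.
by rewrite /cube_adj; congr (_ == 1); apply: eq_card => i; rewrite !inE eq_sym.
Qed.

Lemma cube_adj_neq n (u v : cube n) : cube_adj u v -> u != v.
Proof. by apply: contraL => /eqP->; rewrite cube_adjE hamming_refl. Qed.

Lemma hamming_flatten (I : eqType) (f g : I -> seq bool) (r : seq I) :
  (forall i, size (f i) = size (g i)) ->
  hamming (flatten [seq f i | i <- r]) (flatten [seq g i | i <- r]) =
  \sum_(i <- r) hamming (f i) (g i).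
Proof.
move=> sz; elim: r => [|i r IHr]; first by rewrite big_nil.
by rewrite big_cons /= hamming_cat // IHr.
Qed.

Variables (k n : nat) (p : nat -> nat) (U : forall j, nat -> cube (p j)).
Hypothesis size_p : sumn [seq p j | j <- iota 1 k] = n.

Definition cube_string (l : nat -> nat) : seq bool :=
  flatten [seq tval (U j (l j)) | j <- iota 1 k].

Lemma size_cube_string l : size (cube_string l) = n.
Proof.
rewrite /cube_string size_flatten /shape -map_comp -size_p.
by congr sumn; apply: eq_map => j; rewrite /= size_tuple.
Qed.

(** Arbitrary label functions are allowed, so that the intermediate points of a routing path are
    vertices of the same form as the images of the embedding. *)
Definition vertex l : cube n := [tuple nth false (cube_string l) i | i < n].

Lemma val_vertex l : tval (vertex l) = cube_string l.
Proof.
apply: (@eq_from_nth _ false); first by rewrite size_tuple size_cube_string.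
move=> i; rewrite size_tuple => hi.
by rewrite -[i]/(val (Ordinal hi)) -tnth_nth tnth_mktuple.
Qed.

Lemma vertex_ext l l' : (forall j, 1 <= j <= k -> U j (l j) = U j (l' j)) ->
  vertex l = vertex l'.
Proof.
move=> eq_l; apply: val_inj; rewrite /= !val_vertex; congr flatten.
by apply/eq_in_map => j; rewrite mem_iota => hj; rewrite eq_l //; lia.
Qed.

Lemma vertex_inj l l' : vertex l = vertex l' ->
  forall j, 1 <= j <= k -> U j (l j) = U j (l' j).
Proof.
move/(congr1 (@tval _ _)); rewrite !val_vertex => eq_s j hj.
have := eq_from_flatten_shape eq_s; rewrite /shape -!map_comp.
have -> : [seq (size \o (fun j => tval (U j (l j)))) i | i <- iota 1 k] =
          [seq (size \o (fun j => tval (U j (l' j)))) i | i <- iota 1 k].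
  by apply: eq_map => i; rewrite /= !size_tuple.
move/(_ erefl)/eq_in_map => /(_ j) h; apply: val_inj; apply: h.
by rewrite mem_iota; lia.
Qed.

Lemma vertex_adj l l' j : 1 <= j <= k ->
  (forall i, 1 <= i <= k -> i != j -> l i = l' i) ->
  cube_adj (U j (l j)) (U j (l' j)) -> cube_adj (vertex l) (vertex l').
Proof.
move=> hj eq_l adj; rewrite cube_adjE !val_vertex hamming_flatten; last first.
  by move=> i; rewrite !size_tuple.
have mj : j \in iota 1 k by rewrite mem_iota; lia.
rewrite (bigD1_seq j) ?iota_uniq //=.
rewrite big_seq_cond big1 ?addn0 -?cube_adjE // => i.
rewrite mem_iota => /andP[hi ni]; rewrite (eq_l i) ?hamming_refl //.
Qed.

End CubeSeq.

(** * Labels and adjacency along the leafy cycle *)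

Section Leafy.
Variables (t : nat) (x : nat -> cube t) (y : nat -> nat -> cube t).
Hypotheses (t4 : 4 <= t) (xy : leafy_cycle x y).
Let e := 2 ^ t %/ 16.
Local Notation U := (unlabel x y).

Let eE : 2 ^ t = 16 * e.
Proof.
by rewrite /e mulnC divnK // -[16]/(2 ^ 4) dvdn_exp2l.
Qed.

Let e_gt0 : 0 < e.
Proof. by have : 0 < 2 ^ t by [rewrite expn_gt0]; rewrite eE; case: e. Qed.

Lemma unlabel_center i : U (16 * i) = x i.
Proof. by rewrite /unlabel dvdn_mulr // mulKn. Qed.

Lemma unlabel_leaf i r : 1 <= r <= 15 -> U (16 * i + r) = y i.+1 r.
Proof.
move=> hr; rewrite /unlabel dvdn_addr ?dvdn_mulr //.
rewrite (mulnC 16) divnMDl // modnMDl modn_small; last by lia.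
by rewrite divn_small ?addn0; [case: ifP => //; lia | lia].
Qed.

Lemma unlabel_surj v : exists2 m, 1 <= m <= 2 ^ t & U m = v.
Proof.
have [_ _ /perm_mem pe] := xy; have := pe v.
rewrite mem_enum mem_cat -/e => /orP[/mapP[i]|/allpairsP[[i r] [hi hr ->]]].
  rewrite mem_iota => hi ->; exists (16 * i); last by rewrite unlabel_center.
  by rewrite eE; lia.
rewrite mem_iota [(i, r).1]/= in hi; rewrite mem_iota [(i, r).2]/= in hr.
exists (16 * i.-1 + r); last by rewrite unlabel_leaf ?prednK //; lia.
by rewrite eE; lia.
Qed.

(** A surjection between two sets of size 2^t is injective. *)
Lemma unlabel_inj m m' : 1 <= m <= 2 ^ t -> 1 <= m' <= 2 ^ t ->
  U m = U m' -> m = m'.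
Proof.
pose f (i : 'I_(2 ^ t)) := U i.+1.
have f_onto v : exists i, f i = v.
  have [w hw <-] := unlabel_surj v; have lw : w.-1 < 2 ^ t by lia.
  by exists (Ordinal lw); rewrite /f /= prednK //; case/andP: hw.
have [g gK] := fin_all_exists f_onto.
have [g' g1 g2] : bijective g.
  apply: inj_card_bij; first exact: can_inj gK.
  by rewrite card_ord card_tuple card_bool.
have f_inj : injective f.
  by move=> i j; rewrite -(g2 i) -(g2 j) !gK => ->.
move=> hm hm' eqU; have lm : m.-1 < 2 ^ t by lia.
have lm' : m'.-1 < 2 ^ t by lia.
have : f (Ordinal lm) = f (Ordinal lm').
  by rewrite /f /= !prednK //; [case/andP: hm' | case/andP: hm].
by move/f_inj/(congr1 val) => /=; lia.
Qed.

(** The label of the cycle vertex that carries m: the least multiple of 16 not below m. *)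
Definition center m := 16 * ((m + 15) %/ 16).

Lemma center_bounds m : 1 <= m <= 2 ^ t ->
  1 <= center m <= 2 ^ t /\ m <= center m <= m + 15.
Proof.
rewrite eE /center; have := divn_eq (m + 15) 16.
have : (m + 15) %% 16 < 16 by rewrite ltn_mod.
move: (_ %/ _) (_ %% _) => u v; lia.
Qed.

Lemma cycle_adj i : 1 <= i <= e ->
  cube_adj (x i) (x (if i == e then 1 else i.+1)).
Proof.
move=> hi; have [cyc _ _] := xy; move: cyc; rewrite -/e.
have -> : e = e.-1.+1 by lia.
rewrite /= => /(pathP (x 1)); rewrite size_rcons size_map size_iota.
move/(_ i.-1); have -> : i.-1 < e.-1.+1 by lia.
move/(_ isT); rewrite -rcons_cons nth_rcons /= size_map size_iota.
have -> : i.-1 < e.-1.+1 by lia.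
rewrite -[x 1 :: _]/[seq x j | j <- iota 1 e.-1.+1].
rewrite (nth_map 0) ?size_iota ?nth_iota; try lia.
rewrite nth_rcons size_map size_iota.
have -> : 1 + i.-1 = i by lia.
case: (eqVneq i e.-1.+1) => ie.
  have -> : i.-1 = e.-1 by lia.
  by rewrite ltnn eqxx.
have lt_i : i.-1 < e.-1 by lia.
rewrite lt_i (nth_map 0) ?size_iota // nth_iota //.
by have -> : 2 + i.-1 = i.+1 by lia.
Qed.

(** Equality is included so that a degenerate move, such as from a cycle vertex to its own center,
    needs no separate case. *)
Definition label_adj m m' := U m = U m' \/ cube_adj (U m) (U m').

Lemma label_adj_sym m m' : label_adj m m' -> label_adj m' m.
Proof. by case=> h; [left | right; rewrite cube_adj_sym]. Qed.

Lemma label_adj_center m : 1 <= m <= 2 ^ t -> label_adj m (center m).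
Proof.
move=> hm; have /andP[r0 r1] : 0 <= m %% 16 < 16 by rewrite ltn_mod.
have em := divn_eq m 16; rewrite eE in hm.
case: (posnP (m %% 16)) => hr.
  have e16 : m = 16 * (m %/ 16) by rewrite {1}em hr addn0 mulnC.
  have -> : center m = m; last by left.
  by rewrite /center {1}e16 (mulnC 16 (m %/ 16)) divnMDl // (_ : 15 %/ 16 = 0) // addn0 -e16.
have -> : center m = 16 * (m %/ 16).+1.
  rewrite /center {1}em -addnA divnMDl //.
  have -> : m %% 16 + 15 = 1 * 16 + (m %% 16).-1 by lia.
  have s0 : (m %% 16).-1 %/ 16 = 0 by apply: divn_small; lia.
  by rewrite divnMDl // s0 addn0 addn1.
right; rewrite unlabel_center {1}em mulnC unlabel_leaf; last by lia.
rewrite cube_adj_sym; have [_ h _] := xy; apply: h; rewrite -/e; last by lia.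
move: em hm r1 hr; move: (m %/ 16) (m %% 16) => u v; lia.
Qed.

(** Rounding up adds at most 15 to the cyclic distance, giving at most 30 < 32; hence the cycle
    indices differ cyclically by at most 1. *)
Lemma label_adj_centers m m' (s : int) : 1 <= m <= 2 ^ t -> 1 <= m' <= 2 ^ t ->
  (`|m'%:Z - m%:Z + s * (2 ^ t)%N%:Z| <= 15)%R ->
  label_adj (center m) (center m').
Proof.
move=> hm hm' hs; have [c1 c2] := center_bounds hm.
have [d1 d2] := center_bounds hm'; rewrite /label_adj.
move: c1 c2 d1 d2; rewrite /center eE in hs *.
move: (_ %/ 16) (_ %/ 16) => j i c1 c2 d1 d2; rewrite !unlabel_center.
have hi : 1 <= i <= e by lia.
have hj : 1 <= j <= e by lia.
have h : (`|j%:Z - i%:Z + s * e%:Z| <= 1)%R by lia.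
have : i = j \/ (j = if i == e then 1 else i.+1) \/ (i = if j == e then 1 else j.+1).
  have [s0|[s1|s1]] : s = 0%R \/ s = 1%R \/ s = (-1)%R by nia.
  - by rewrite s0 in h; case: (eqVneq i e); case: (eqVneq j e); lia.
  - by rewrite s1 in h; case: (eqVneq i e); case: (eqVneq j e); lia.
  - by rewrite s1 in h; case: (eqVneq i e); case: (eqVneq j e); lia.
case=> [->|[]]; [by left | |] => ->; right; last rewrite cube_adj_sym.
  exact: cycle_adj.
exact: cycle_adj.
Qed.

End Leafy.

(** * Routing and congestion *)

Lemma mem_iota1 q i : (i \in iota 1 q) = (1 <= i <= q).
Proof. by rewrite mem_iota add1n ltnS. Qed.

(* c - m is congruent modulo q to an integer in [-30, 30]. *)
Definition near q m c := has (fun o => c + o == m + 30 %[mod q]) (iota 0 61).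

Lemma int_eqmod q u v (s : int) : (u%:Z = v%:Z + s * q%:Z)%R -> u = v %[mod q].
Proof.
case: s => s h.
  have -> : u = s * q + v by lia.
  by rewrite modnMDl.
have -> : v = s.+1 * q + u by lia.
by rewrite modnMDl.
Qed.

Lemma nearP q m c (s : int) :
  (`|c%:Z - m%:Z + s * q%:Z| <= 30)%R -> near q m c.
Proof.
move=> h; apply/hasP; exists (absz (30 - (c%:Z - m%:Z + s * q%:Z))%R).
  by rewrite mem_iota; lia.
by apply/eqP/(@int_eqmod _ _ _ (- s)%R); lia.
Qed.

Lemma near_inj q m m' c o : 1 <= m <= q -> 1 <= m' <= q ->
  c + o = m + 30 %[mod q] -> c + o = m' + 30 %[mod q] -> m = m'.
Proof.
move=> hm hm' -> /eqP; rewrite eqn_modDr => /eqP.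
have := @mod_resid q m m'; rewrite /resid.
case: m m' hm hm' => [|m] [|m'] //= hm hm' h e.
move: (h isT isT); rewrite e eqxx => /esym.
by rewrite !modn_small // => /eqP.
Qed.

Section Routing.
Variables (X : forall t, nat -> cube t) (Y : forall t, nat -> nat -> cube t).
Hypothesis leafy : forall t, 22 <= t -> leafy_cycle (X t) (Y t).
Variables (k n : nat) (p : nat -> nat).
Hypothesis p22 : forall j, 1 <= j <= k -> 22 <= p j.
Hypothesis size_p : sumn [seq p j | j <- iota 1 k] = n.

Definition block_label j := unlabel (X (p j)) (Y (p j)).
Local Notation U := block_label.
Local Notation V := (vertex k n U).

Lemma block_leafy j : 1 <= j <= k ->
  4 <= p j /\ leafy_cycle (X (p j)) (Y (p j)).
Proof. by move/p22 => h; split; [apply: leq_trans h | apply: leafy]. Qed.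

Lemma block_label_inj j m m' : 1 <= j <= k ->
  1 <= m <= 2 ^ p j -> 1 <= m' <= 2 ^ p j -> U j m = U j m' -> m = m'.
Proof. by move=> /block_leafy[h1 h2]; apply: unlabel_inj. Qed.

Definition mix (l l' : nat -> nat) j c i :=
  if i < j then l' i else if i == j then c else l i.

(** A cube adjacency that also remembers the block being corrected and the labels passed, so each
    edge of a walk retains what the congestion count needs. *)
Definition route_rel l l' : rel (cube n) := fun u v => cube_adj u v &&
  has (fun j => has (fun c => has (fun c' =>
    [&& near (2 ^ p j) (l j) c, near (2 ^ p j) (l j) c',
        u == V (mix l l' j c) & v == V (mix l l' j c')])
    (iota 1 (2 ^ p j))) (iota 1 (2 ^ p j))) (iota 1 k).

Variables l l' : nat -> nat.
Hypothesis l_bounds : forall j, 1 <= j <= k -> 1 <= l j <= 2 ^ p j.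
Hypothesis l'_bounds : forall j, 1 <= j <= k -> 1 <= l' j <= 2 ^ p j.
Hypothesis l_close : forall j, 1 <= j <= k ->
  exists s : int, (`|(l' j)%:Z - (l j)%:Z + s * (2 ^ p j)%N%:Z| <= 15)%R.

Lemma route_relP u v : route_rel l l' u v -> cube_adj u v /\
  exists j c c', [/\ 1 <= j <= k, 1 <= c <= 2 ^ p j, 1 <= c' <= 2 ^ p j,
    near (2 ^ p j) (l j) c /\ near (2 ^ p j) (l j) c' &
    u = V (mix l l' j c) /\ v = V (mix l l' j c')].
Proof.
case/andP=> uv /hasP[j hj] /hasP[c hc] /hasP[c' hc'] /and4P[h1 h2 /eqP eu /eqP ev].
by split=> //; exists j, c, c'; split; rewrite // -?mem_iota1.
Qed.

Lemma route_step j c c' : 1 <= j <= k ->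
  1 <= c <= 2 ^ p j -> 1 <= c' <= 2 ^ p j ->
  near (2 ^ p j) (l j) c -> near (2 ^ p j) (l j) c' ->
  label_adj (X (p j)) (Y (p j)) c c' ->
  walk_le (route_rel l l') 1 (V (mix l l' j c)) (V (mix l l' j c')).
Proof.
move=> hj hc hc' nc nc' [eq_c | adj_c].
  have -> : V (mix l l' j c) = V (mix l l' j c').
    apply: vertex_ext => // i hi; rewrite /mix; case: ifP => // _.
    by case: eqVneq => // ->.
  by exists [::].
exists [:: V (mix l l' j c')]; split=> //=; rewrite andbT.
apply/andP; split.
  apply: (@vertex_adj _ _ _ _ size_p _ _ j) => //.
    by move=> i hi ni; rewrite /mix (negPf ni).
  by rewrite /mix ltnn eqxx.
apply/hasP; exists j; first by rewrite mem_iota1.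
apply/hasP; exists c; first by rewrite mem_iota1.
apply/hasP; exists c'; first by rewrite mem_iota1.
by rewrite nc nc' !eqxx.
Qed.

(** Three moves: to the center of the old label, to the center of the new label, to the new
    label. *)
Lemma route_stage j : 1 <= j <= k ->
  walk_le (route_rel l l') 3 (V (mix l l' j (l j))) (V (mix l l' j (l' j))).
Proof.
move=> hj; have [t4 leaf] := block_leafy hj.
have [s hs] := l_close hj; have ha := l_bounds hj; have hb := l'_bounds hj.
have [ca1 ca2] := center_bounds t4 ha.
have [cb1 cb2] := center_bounds t4 hb.
have na : near (2 ^ p j) (l j) (l j) by apply: (@nearP _ _ _ 0%R); lia.
have nca : near (2 ^ p j) (l j) (center (l j)) by apply: (@nearP _ _ _ 0%R); lia.
have nb : near (2 ^ p j) (l j) (l' j) by apply: (@nearP _ _ _ s); lia.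
(* The farthest label met: 15 from the change of label plus 15 from centering, whence the radius 30
   in [near]. *)
have ncb : near (2 ^ p j) (l j) (center (l' j)) by apply: (@nearP _ _ _ s); lia.
apply: (@walk_le_trans _ _ 1 2 _ (V (mix l l' j (center (l j))))).
  by apply: route_step => //; apply: label_adj_center.
apply: (@walk_le_trans _ _ 1 1 _ (V (mix l l' j (center (l' j))))).
  by apply: route_step => //; apply: (label_adj_centers t4 leaf (s := s)).
by apply: route_step => //; apply/label_adj_sym/label_adj_center.
Qed.

Lemma route_walk : walk_le (route_rel l l') (3 * k) (V l) (V l').
Proof.
pose mid j := V (fun i => if i < j then l' i else l i).
suff h m : m <= k -> walk_le (route_rel l l') (3 * m) (V l) (mid m.+1).
  have <- : mid k.+1 = V l'; last exact: h.
  by apply: vertex_ext => // j hj; rewrite ltnS (proj2 (andP hj)).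
elim: m => [|m IHm] hm.
  have -> : mid 1 = V l; last exact: walk_le0.
  by apply: vertex_ext => // -[].
rewrite mulnSr; apply: walk_le_trans (IHm (ltnW hm)) _.
have e1 : mid m.+1 = V (mix l l' m.+1 (l m.+1)).
  apply: vertex_ext => // i hi; rewrite /mix; case: ifP => // _.
  by case: eqVneq => // ->.
have e2 : mid m.+2 = V (mix l l' m.+1 (l' m.+1)).
  apply: vertex_ext => // i hi; rewrite /mix ltnS leq_eqVlt.
  by case: ltngtP => // ->.
by rewrite e1 e2; apply: route_stage.
Qed.

End Routing.

(** Counts by codes given as a relation: an element may have several codes, but a code belongs to at
    most one element. *)
Lemma card_le_rel (S T : finType) (A : {set S}) (P : S -> T -> Prop) :
  (forall s, s \in A -> exists t, P s t) ->
  (forall s s' t, P s t -> P s' t -> s = s') -> #|A| <= #|T|.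
Proof.
move=> P_ex P_inj; have [->|[s0 s0A]] := set_0Vmem A; first by rewrite cards0.
have [t0 _] := P_ex s0 s0A.
have [|f fP] := @fin_all_exists S (fun=> T) (fun s t => s \in A -> P s t).
  move=> s; case: (boolP (s \in A)) => [sA | _]; last by exists t0.
  by have [t Pt] := P_ex s sA; exists t.
rewrite -(@card_in_imset _ _ f A) ?max_card // => s s' sA s'A eq_f.
by apply: (P_inj s s' (f s)); [exact: fP | rewrite eq_f; exact: fP].
Qed.

Lemma set2_eq (T : finType) (x y u v : T) : [set x; y] = [set u; v] ->
  x = u /\ y = v \/ x = v /\ y = u.
Proof.
move=> eq_s.
have /set2P hx : x \in [set u; v] by rewrite -eq_s set21.
have /set2P hy : y \in [set u; v] by rewrite -eq_s set22.
have /set2P hu : u \in [set x; y] by rewrite eq_s set21.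
have /set2P hv : v \in [set x; y] by rewrite eq_s set22.
by intuition congruence.
Qed.

(** * Dilation and congestion of the embedding *)

Section Embedding.
Variables (X : forall t, nat -> cube t) (Y : forall t, nat -> nat -> cube t).
Hypothesis leafy : forall t, 22 <= t -> leafy_cycle (X t) (Y t).
Variables (k : nat) (a : nat -> nat) (F : nat -> nat -> nat -> bool).
Hypothesis k2 : 2 <= k.
Hypothesis a_large : forall i, 1 <= i <= k -> 2 ^ 22 <= a i.
Hypothesis F_round : forall i, 2 <= i < k -> blank_rounding k a i (F i).
Local Notation grid := (grid k a).
Local Notation n := (opt_dim grid).
Implicit Types x y lo hi : grid.

Let H : grid -> cube n := Hk F X Y.
Local Notation U := (block_label X Y (p_ a)).
Local Notation V := (vertex k n U).
Local Notation label x := (fun j => Lab F j x).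

Lemma sum_p : sumn [seq p_ a j | j <- iota 1 k] = n.
Proof.
rewrite -e_k_opt_dim; suff h i : i <= k -> sumn [seq p_ a j | j <- iota 1 i] = e_ a i.
  exact: h.
elim: i => [|i IHi] hi; first by rewrite /e_ big_geq.
rewrite iota1S map_cat sumn_cat IHi ?(ltnW hi) //= addn0 /p_ subnKC //=.
by have := e_mono k2 a_large hi; lia.
Qed.

Let p22 j : 1 <= j <= k -> 22 <= p_ a j.
Proof. exact: (p_ge22 k2 a_large). Qed.

Lemma Hk_vertex x : H x = V (label x).
Proof.
rewrite -[H x]/(V (fun j => nth 0 (f_ F k x) j.-1)).
by apply: vertex_ext (sum_p) _ _ _ => j hj; rewrite f_kE.
Qed.

Lemma vertex_labels l l' :
  (forall j, 1 <= j <= k -> 1 <= l j <= side a j) ->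
  (forall j, 1 <= j <= k -> 1 <= l' j <= side a j) ->
  V l = V l' -> forall j, 1 <= j <= k -> l j = l' j.
Proof.
move=> hl hl' eqV j hj; have := vertex_inj sum_p eqV hj.
by apply: (block_label_inj leafy p22) => //; [apply: hl | apply: hl'].
Qed.

Lemma Hk_inj : injective H.
Proof.
move=> x y; rewrite !Hk_vertex => eqV; apply: (Lab_inj k2 a_large F_round).
by apply: vertex_labels eqV => j hj; apply: Lab_bounds.
Qed.

Definition close_labels x y := forall j, 1 <= j <= k ->
  exists s : int, (`|(Lab F j y)%:Z - (Lab F j x)%:Z + s * (side a j)%:Z| <= 15)%R.

Lemma step_close R x y : step R x y -> close_labels x y.
Proof. by move=> xy j hj; apply: step_Lab xy hj. Qed.

Lemma close_labels_sym x y : close_labels x y -> close_labels y x.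
Proof. by move=> xy j /xy[s hs]; exists (- s)%R; lia. Qed.

Lemma Hk_walk x y : close_labels x y ->
  walk_le (route_rel X Y k (p_ a) (label x) (label y)) (3 * k) (H x) (H y).
Proof.
move=> xy; rewrite !Hk_vertex; apply: route_walk => //.
- exact: sum_p.
- by move=> j hj; apply: Lab_bounds.
- by move=> j hj; apply: Lab_bounds.
Qed.

Lemma Hk_dilation : dilation (@grid_adj k a) (@cube_adj _) H <= 3 * k.
Proof.
apply/bigmax_leqP => x _; apply/bigmax_leqP => y /(grid_adj_step k2)[R xy].
have {}xy : close_labels x y by case: xy => [/step_close | /step_close /close_labels_sym].
by apply: gdist_le; apply: walk_le_sub (Hk_walk xy) => u v /andP[].
Qed.

Lemma step_fun R x y y' : step R x y -> step R x y' -> y = y'.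
Proof.
move=> [hR h1 h2] [_ g1 g2]; apply: coord_inj => j hj.
by case: (eqVneq j R) => [->|nj]; [rewrite h1 g1 | rewrite h2 // g2].
Qed.

Definition routed lo hi (u v : cube n) :=
  route_rel X Y k (p_ a) (label lo) (label hi) u v.

Definition good_route (A : {set grid}) (s : seq (cube n)) := exists R lo hi,
  [/\ step R lo hi, A = [set lo; hi], joins (@cube_adj _) (H lo) (H hi) s
    & forall B, B \in path_edges s ->
        exists u v, routed lo hi u v /\ B = [set u; v]].

Lemma routing_ex : exists r : {set grid} -> seq (cube n),
  forall A, A \in edges (@grid_adj k a) -> good_route A (r A).
Proof.
apply: (@fin_all_exists _ (fun=> seq (cube n))
  (fun A s => A \in edges (@grid_adj k a) -> good_route A s)) => A.
case: (boolP (A \in edges _)) => [/imsetP[[x y] /= xy ->]|_]; last by exists [::].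
have [R [lo [hi [lohi eA]]]] : exists R lo hi, step R lo hi /\ [set x; y] = [set lo; hi].
  have [R [s|s]] := grid_adj_step k2 xy; first by exists R, x, y.
  by exists R, y, x; rewrite setUC.
have [q [pq lq uq]] := walk_simple (Hk_walk (step_close lohi)).
exists (H lo :: q) => _; exists R, lo, hi; split=> //.
  rewrite /joins eqxx lq eqxx uq !andbT.
  by apply: sub_path pq => u v /andP[].
by move=> B; apply: path_edgesP.
Qed.

(* t = (R, o, d): R is the direction of the edge, o the offset of the label of
   lo in the block j where b0 and b1 differ, and d - 5 the deviation of the
   level difference of the two ends from its expected value; the level of stage
   j is not defined for j = 1, where the labels of lo are all known. *)
Definition edge_code (b0 b1 : cube n) (A : {set grid})
    (t : 'I_k * 'I_61 * 'I_11) := exists lo hi j c0 c1,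
  [/\ step t.1.1.+1 lo hi /\ A = [set lo; hi],
      [/\ 1 <= j <= k, 1 <= c0 <= side a j & 1 <= c1 <= side a j],
      b0 = V (mix (label lo) (label hi) j c0) /\
      b1 = V (mix (label lo) (label hi) j c1),
      c0 + t.1.2 = Lab F j lo + 30 %[mod side a j]
    & 2 <= j -> top F (j - 2) hi + 5 =
        top F (j - 2) lo + shift a t.1.1.+1 j %/ 2 ^ e_ a j.-1 + t.2].

Lemma edge_code_ex b0 b1 R lo hi u v :
  step R lo hi -> routed lo hi u v -> [set b0; b1] = [set u; v] ->
  exists t, edge_code b0 b1 [set lo; hi] t.
Proof.
move=> lohi /route_relP[uv [j [c [c' [hj hc hc' [nc nc'] [eu ev]]]]]] eB.
have [c0 [c1 [hc0 hc1 nc0 [e0 e1]]]] : exists c0 c1,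
  [/\ 1 <= c0 <= side a j, 1 <= c1 <= side a j, near (side a j) (Lab F j lo) c0 &
      b0 = V (mix (label lo) (label hi) j c0) /\
      b1 = V (mix (label lo) (label hi) j c1)].
  (* The edge may be traversed in either direction; [route_rel] asks for [near] at both labels so
     that either can serve as [c0]. *)
  by case: (set2_eq eB) => -[-> ->]; [exists c, c' | exists c', c]; split.
have [o ho eo] := hasP nc0.
have hR : R.-1 < k by case: lohi; lia.
have oo : o < 61 by move: ho; rewrite mem_iota.
have R1 : R.-1.+1 = R by case: lohi; lia.
have [d hd] : exists d : 'I_11, 2 <= j -> top F (j - 2) hi + 5 =
    top F (j - 2) lo + shift a R j %/ 2 ^ e_ a j.-1 + d.
  case: (leqP 2 j) => j2; last by exists ord0.
  have ej : j = (j - 2).+2 by lia.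
  have hm : (j - 2).+2 <= k by lia.
  have := step_top k2 a_large F_round hm lohi.
  rewrite -ej; have -> : (j - 2).+1 = j.-1 by lia.
  have E0 : 0 < 2 ^ e_ a j.-1 by rewrite expn_gt0.
  move: (2 ^ _) (shift _ _ _) (top _ _ _) (top _ _ _) E0 => E s z1 z2 E0 hs.
  have es := divn_eq s E; have ls := ltn_pmod s E0.
  move: (s %/ E) (s %% E) es ls => w r es ls.
  (* The shift is w E + r with r < E. Dropping r turns the error range from -5 E to 5 E into -5 E to
     less than 6 E, so the deviation from w is one of 11 integers. *)
  have b1' : (E%:Z * (z2%:Z - z1%:Z - w%:Z) < E%:Z * 6)%R by lia.
  have b2' : (E%:Z * - 5 <= E%:Z * (z2%:Z - z1%:Z - w%:Z))%R by lia.
  have E0' : (0 < E%:Z)%R by lia.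
  rewrite ltr_pM2l // in b1'; rewrite ler_pM2l // in b2'.
  have d11 : z2 + 5 - (z1 + w) < 11 by lia.
  by exists (Ordinal d11) => _ /=; lia.
exists (Ordinal hR, Ordinal oo, d), lo, hi, j, c0, c1.
by split; rewrite /= ?R1 //; apply/eqP.
Qed.

Lemma mix_bounds lo hi j c : 1 <= j <= k -> 1 <= c <= side a j ->
  forall i, 1 <= i <= k -> 1 <= mix (label lo) (label hi) j c i <= side a i.
Proof.
move=> hj hc i hi'; rewrite /mix; case: ifP => _; first exact: Lab_bounds.
by case: eqVneq => [->|_] //; apply: Lab_bounds.
Qed.

(* The labels of lo in the blocks >= j determine its level at stage j, hence,
   with d, the level of hi; together with the labels of hi in the blocks < j
   this determines hi. *)
Lemma edge_code_inj b0 b1 A A' t : b0 != b1 ->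
  edge_code b0 b1 A t -> edge_code b0 b1 A' t -> A = A'.
Proof.
move=> b01 [lo [hi [j [c0 [c1 [[st ->] [hj hc0 hc1] [e0 e1] eo ed]]]]]].
case=> [lo' [hi' [j' [c0' [c1' [[st' ->] [hj' hc0' hc1'] [e0' e1'] eo' ed']]]]]].
have c01 : c0 != c1 by apply: contraNneq b01 => ec; rewrite e0 e1 ec.
have m0 := vertex_labels (mix_bounds lo hi hj hc0) (mix_bounds lo' hi' hj' hc0')
  (etrans (esym e0) e0').
have m1 := vertex_labels (mix_bounds lo hi hj hc1) (mix_bounds lo' hi' hj' hc1')
  (etrans (esym e1) e1').
have jj : j = j'.
  (* If the blocks differed, the second code would give b0 and b1 the same label in block j, forcing
     [c0 = c1]. *)
  apply/eqP; apply: contraNT c01 => nj; have := m0 j hj; have := m1 j hj.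
  by rewrite /mix ltnn eqxx (negPf nj) => -> ->.
subst j'; have cc : c0 = c0' by have := m0 j hj; rewrite /mix ltnn eqxx.
subst c0'.
have ej : Lab F j lo = Lab F j lo'.
  by apply: near_inj eo eo'; apply: Lab_bounds.
clear eo eo'.
have hi_eq l : 1 <= l < j -> Lab F l hi = Lab F l hi'.
  move=> hl; have := m0 l; rewrite /mix; case/andP: (hl) => _ ->.
  by apply; lia.
have lo_eq l : j <= l <= k -> Lab F l lo = Lab F l lo'.
  move=> hl; case: (eqVneq l j) => [->//|nl].
  have := m0 l; rewrite /mix (negPf nl); have -> : l < j = false by lia.
  by apply; lia.
case: (leqP 2 j) => j2; last first.
  have ll : lo = lo'.
    by apply: (Lab_inj k2 a_large F_round) => l hl; apply: lo_eq; lia.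
  by subst lo'; rewrite (step_fun st st').
have hm : (j - 2).+2 <= k by lia.
have et : top F (j - 2) lo = top F (j - 2) lo'.
  by apply: (top_det k2 a_large F_round) => // l hl; apply: lo_eq; lia.
have eh : hi = hi'.
  apply: (Lab_inj_prefix k2 a_large F_round hm) => [l hl|].
    by apply: hi_eq; lia.
  by have := ed j2; have := ed' j2; rewrite et; lia.
by subst hi'; rewrite (step_inj k2 st st').
Qed.

Lemma Hk_congestion (r : {set grid} -> seq (cube n)) :
  (forall A, A \in edges (@grid_adj k a) -> good_route A (r A)) ->
  congestion (@grid_adj k a) (@cube_adj _) r <= 61 * 11 * k.
Proof.
move=> rP; apply/bigmax_leqP => B /imsetP[[b0 b1] /= b01 ->].
have -> : 61 * 11 * k = #|{: 'I_k * 'I_61 * 'I_11}|.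
  by rewrite !card_prod !card_ord; lia.
apply: (@card_le_rel _ _ _ (edge_code b0 b1)) => [A|A A' t].
  rewrite inE => /andP[/rP[R [lo [hi [st -> _ hB]]]] /hB[u [v [uv eB]]]].
  exact: edge_code_ex st uv eB.
by apply: edge_code_inj; apply: cube_adj_neq.
Qed.

End Embedding.

Theorem mainTheorem2 :
  exists C : nat,
    forall (X : forall t, nat -> cube t) (Y : forall t, nat -> nat -> cube t),
    (forall t, 22 <= t -> leafy_cycle (X t) (Y t)) ->
    forall (k : nat) (a : nat -> nat),
    2 <= k ->
    (forall i, 1 <= i <= k -> 2 ^ 22 <= a i) ->
    forall F : nat -> nat -> nat -> bool,
    (forall i, 2 <= i < k -> blank_rounding k a i (F i)) ->
    let H : grid k a -> cube (opt_dim (grid k a)) := Hk F X Y in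
    [/\ injective H,
        dilation (@grid_adj k a) (@cube_adj _) H <= 3 * k
      & exists2 r : {set grid k a} -> seq (cube (opt_dim (grid k a))),
          routing (@grid_adj k a) (@cube_adj _) H r
        & congestion (@grid_adj k a) (@cube_adj _) r <= C * k].
Proof.
exists (61 * 11) => X Y leafy k a k2 a_large F F_round H; split.
- exact: (@Hk_inj X Y leafy k a F k2 a_large F_round).
- exact: (@Hk_dilation X Y leafy k a F k2 a_large F_round).
have [r rP] := @routing_ex X Y leafy k a F k2 a_large F_round.
exists r; last exact: (@Hk_congestion X Y leafy k a F k2 a_large F_round).
move=> x y xy; have xyE : [set x; y] \in edges (@grid_adj k a).
  by apply/imsetP; exists (x, y).
(* The stored path runs from the lower end to the upper one, which may be either of x and y. *)
have [R [lo [hi [lohi eA jn _]]]] := rP _ xyE.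
have [[-> ->]|[-> ->]] := set2_eq eA; first by rewrite -eA jn.
by rewrite setUC -eA jn orbT.
Qed.
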